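(* Let $n\ge 3$ and let $(W,S)$ be a Coxeter system whose nerve is the complete graph $K_n$ (so $|S|=n$, every pair of distinct generators spans a finite special subgroup and no three do), with all edges labeled by the same integer $m\ge n-1$, i.e. $m_{st}=m$ for all $s\ne t$. Then $L^2_\mathbf{q}H_2(\Sigma(W,S))=0$ for every multiparameter $\mathbf{q}\le\mathbf{1}$.
   Context: The nerve $L$ of $(W,S)$ is the simplicial complex with vertex set $S$ whose simplices are the nonempty spherical subsets $U\subseteq S$ (those with $\langle U\rangle$ finite); the edge $\{s,t\}$ is labeled by $m_{st}$. A multiparameter is $\mathbf{q}=(q_s)_{s\in S}$, $q_s>0$, constant on conjugacy classes, and $\mathbf{q}\le\mathbf{1}$ means $q_s\le 1$ for all $s$. Weighted $L^2$-homology of the Davis complex $\Sigma(W,S)$: cell $w\sigma$ gets measure $q_u$, $u$ the shortest element of $wW_{S(\sigma)}$ ($S(\sigma)$ the type of $\sigma$); chains square-summable for $\sum f(\sigma)g(\sigma)\mu_\mathbf{q}(\sigma)$; boundary $\partial^\mathbf{q}$ the adjoint of the coboundary; $L^2_\mathbf{q}H_i=\ker\partial^\mathbf{q}_i/\overline{\operatorname{im}\partial^\mathbf{q}_{i+1}}$. *)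

(* Defs.v *)
From Stdlib Require Import Reals ClassicalEpsilon.
From mathcomp Require Import all_boot.

Set Implicit Arguments.
Unset Strict Implicit.
Unset Printing Implicit Defensive.

(* the real-number scope of Stdlib (the key %R is taken by MathComp) *)
Delimit Scope R_scope with Re.

Fixpoint alt (n : nat) (i j : 'I_n) (k : nat) : seq 'I_n :=
  match k with 0 => [::] | k'.+1 => i :: alt j i k' end.

Inductive cox_eq (n m : nat) : seq 'I_n -> seq 'I_n -> Prop :=
| ce_refl w : cox_eq m w w
| ce_sym w w' : cox_eq m w w' -> cox_eq m w' w
| ce_trans w1 w2 w3 : cox_eq m w1 w2 -> cox_eq m w2 w3 -> cox_eq m w1 w3
| ce_sq (a b : seq 'I_n) (i : 'I_n) : cox_eq m (a ++ [:: i; i] ++ b) (a ++ b)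
| ce_braid (a b : seq 'I_n) (i j : 'I_n) :
    i != j -> cox_eq m (a ++ alt i j (2 * m) ++ b) (a ++ b).

Definition over (n : nat) (T : seq 'I_n) (v : seq 'I_n) : bool :=
  all (fun a => a \in T) v.

(* the special subgroup W_T is finite (T spherical) *)
Definition spherical (n m : nat) (T : seq 'I_n) : Prop :=
  exists N : nat, forall v, over T v ->
    exists v', cox_eq m v v' /\ size v' <= N.

Definition same_coset (n m : nat) (T : seq 'I_n) (w w' : seq 'I_n) : Prop :=
  exists v, over T v /\ cox_eq m (w ++ v) w'.

Definition min_coset_rep (n m : nat) (T : seq 'I_n) (u : seq 'I_n) : Prop :=
  forall v w', over T v -> cox_eq m (u ++ v) w' -> size u <= size w'.

Definition minrep (n m : nat) (T : seq 'I_n) (w : seq 'I_n) : seq 'I_n :=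
  epsilon (inhabits [::]) (fun u => same_coset m T w u /\ min_coset_rep m T u).

Definition wordweight (n : nat) (q : 'I_n -> R) (w : seq 'I_n) : R :=
  foldr (fun a r => (q a * r)%Re) 1%Re w.

Definition cellweight (n m : nat) (q : 'I_n -> R) (T : seq 'I_n) (w : seq 'I_n) : R :=
  wordweight q (minrep m T w).

Definition conj_invariant (n m : nat) (q : 'I_n -> R) : Prop :=
  forall s t : 'I_n, (exists x : seq 'I_n, cox_eq m (x ++ s :: rev x) [:: t]) ->
    q s = q t.

(* Cells of the Davis complex:
   - 1-cell of type {s}: coset y W_{s} = {y, ys}, oriented from the shorter
     to the longer vertex; represented by (y, s).
   - 2-cell of type {i,j}, i < j: coset w W_{ij}, a 2m-gon; with u the
     shortest element, it is oriented as the cycle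
       u -> u i -> u i j -> ... -> u w_0 -> ... -> u j -> u.
   Its boundary as a list of (edge, sign): *)
Definition bdry2 (n m : nat) (i j : 'I_n) (u : seq 'I_n) : seq (seq 'I_n * 'I_n * R) :=
  [seq (u ++ alt i j k, (if odd k then j else i), 1%Re) | k <- iota 0 m] ++
  [seq (u ++ alt j i k, (if odd k then i else j), (-1)%Re) | k <- iota 0 m].

Definition edge_match (n m : nat) (e : seq 'I_n * 'I_n) (s : 'I_n) (x : seq 'I_n) : Prop :=
  e.2 = s /\ same_coset m [:: s] e.1 x.

Definition incidence (n m : nat) (i j : 'I_n) (w : seq 'I_n) (s : 'I_n) (x : seq 'I_n) : R :=
  foldr (fun e r => ((if excluded_middle_informative (edge_match m e.1 s x)
                      then e.2 else 0) + r)%Re)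
        0%Re (bdry2 m i j (minrep m [:: i; j] w)).

(* A 2-chain: f i j w (for i < j) is the value on the cell w W_{ij};
   it must only depend on the cell. *)
Definition two_chain (n m : nat) (f : 'I_n -> 'I_n -> seq 'I_n -> R) : Prop :=
  forall (i j : 'I_n) (w w' : seq 'I_n), i < j ->
    same_coset m [:: i; j] w w' -> f i j w = f i j w'.

Definition cell_eq (n m : nat) (c c' : 'I_n * 'I_n * seq 'I_n) : Prop :=
  c.1 = c'.1 /\ same_coset m [:: c.1.1; c.1.2] c.2 c'.2.

Fixpoint distinct_cells (n m : nat) (L : seq ('I_n * 'I_n * seq 'I_n)) : Prop :=
  match L with
  | [::] => True
  | c :: L' => (forall c', c' \in L' -> ~ cell_eq m c c') /\ distinct_cells m L'
  end.

(* square-summability for the weighted inner product: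
   sum over all 2-cells of f(sigma)^2 mu_q(sigma) < oo, i.e. the finite
   partial sums over distinct cells are bounded. *)
Definition sq_summable (n m : nat) (q : 'I_n -> R) (f : 'I_n -> 'I_n -> seq 'I_n -> R) : Prop :=
  exists C : R, forall L : seq ('I_n * 'I_n * seq 'I_n),
    all (fun c : 'I_n * 'I_n * seq 'I_n => c.1.1 < c.1.2) L -> distinct_cells m L ->
    (foldr (fun (c : 'I_n * 'I_n * seq 'I_n) r => f c.1.1 c.1.2 c.2 ^ 2 * cellweight m q [:: c.1.1; c.1.2] c.2 + r)
           0 L <= C)%Re.

(* partial_2^q f = 0, where partial^q is the adjoint of the coboundary for
   the weighted inner product:
   (partial^q f)(tau) = mu(tau)^{-1} sum_{sigma} [sigma:tau] mu(sigma) f(sigma);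
   the 2-cells containing tau = x W_{s} are the x W_{st}, t <> s. *)
Definition q_cycle2 (n m : nat) (q : 'I_n -> R) (f : 'I_n -> 'I_n -> seq 'I_n -> R) : Prop :=
  forall (s : 'I_n) (x : seq 'I_n),
    foldr Rplus 0%Re
      [seq (let i := if s < t then s else t in
            let j := if s < t then t else s in
            (incidence m i j x s x * cellweight m q [:: i; j] x * f i j x)%Re)
      | t : 'I_n <- enum 'I_n & t != s] = 0%Re.

(* L^2_q H_2(Sigma) = ker partial_2^q / closure(im partial_3^q); here Sigma is
   2-dimensional (no spherical triples), so C_3 = 0 and the statement
   L^2_q H_2 = 0 means ker partial_2^q = 0. *)
Definition L2qH2_vanishes (n m : nat) (q : 'I_n -> R) : Prop :=
  forall f : 'I_n -> 'I_n -> seq 'I_n -> R,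
    two_chain m f -> sq_summable m q f -> q_cycle2 m q f ->
    forall (i j : 'I_n) (w : seq 'I_n), i < j -> f i j w = 0%Re.

(* Main.v *)
(** Since q <= 1, multiplying a weighted cycle by the cell measure gives an
    unweighted square-summable cycle.  Twisting by the sign character and
    orienting the cell x W_{st} by the ordered pair (s, t), such a cycle is a
    function F(s, t, x), antisymmetric in s and t, constant on the cosets
    x W_{st}, with sum_t F(s, t, x) = 0 for all s and x; these conditions are
    invariant under left translation, so it suffices that F vanishes at x = 1.

    Each cell has 2m edges, and an edge far from the bottom of one cell is a
    bottom edge of the n - 2 other cells containing it (for m >= 3, since a
    descent set contains no three generators).  The cycle equation and
    Cauchy-Schwarz on the edges at height k >= 2 (with weight 1 for k = 2 and 2
    for k >= 3) give (2m - 5) E <= (n - 2) (E - E_1), where E is the energy of F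
    and E_1 > 0 unless F vanishes on the cells at the identity.  This settles
    all cases with n - 2 <= 2m - 5, that is, all but n = 4, m = 3.

    For n = 4, m = 3 the group has a height function, equivariant under a
    finite-index subgroup, with two ascending and two descending edges at every
    vertex.  A cycle is then determined by its values at height 0; as the
    stabilizer N of the height has finitely many orbits at height 0 and
    infinitely many in all, a von Neumann dimension count over N shows that
    there is no nonzero square-summable cycle.  When m = 2 (so n = 3) the
    triple of generators would be spherical. *)
Require Import Defs.
From HB Require Import structures.
From Stdlib Require Import Reals Lra ZArith Lia ClassicalEpsilon.
From Stdlib Require Import FunctionalExtensionality PropExtensionality.
From mathcomp Require Import all_boot zify_ssreflect.

Set Implicit Arguments.
Unset Strict Implicit.
Unset Printing Implicit Defensive.

(** * The Coxeter group as a group of shortest words *)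

Section CoxeterWords.

Context {n m : nat}.
Implicit Types (a b c w : seq 'I_n) (i j : 'I_n).

Lemma ce_context a b c d : cox_eq m a b -> cox_eq m (c ++ a ++ d) (c ++ b ++ d).
Proof.
elim=> {a b} [w|a b _ IH|a b e _ IH1 _ IH2|a b i|a b i j nij].
- exact: ce_refl.
- exact: ce_sym.
- exact: ce_trans IH1 IH2.
- by have := ce_sq m (c ++ a) (b ++ d) i; rewrite -!catA.
- by have := ce_braid m (c ++ a) (b ++ d) nij; rewrite -!catA.
Qed.

Lemma ce_cat a a' b b' :
  cox_eq m a a' -> cox_eq m b b' -> cox_eq m (a ++ b) (a' ++ b').
Proof.
move=> ha hb; apply: (ce_trans (w2 := a' ++ b)).
  exact: (ce_context [::] b ha).
by have := ce_context a' [::] hb; rewrite !cats0.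
Qed.

Lemma size_alt i j k : size (alt i j k) = k.
Proof. by elim: k i j => //= k IH i j; rewrite IH. Qed.

Lemma alt_cat i j k l :
  alt i j (k + l) = alt i j k ++ (if odd k then alt j i l else alt i j l).
Proof.
elim: k i j => //= k IH i j; rewrite IH; case: (odd k) => //=.
Qed.

Lemma alt_rcons i j k : alt i j k.+1 = rcons (alt i j k) (if odd k then j else i).
Proof. by rewrite -addn1 alt_cat -cats1; case: (odd k). Qed.

Lemma rev_alt i j k : rev (alt i j k) = if odd k then alt i j k else alt j i k.
Proof.
elim: k i j => //= k IH i j; rewrite rev_cons IH.
case: (boolP (odd k)) => ok /=.
  by have := alt_rcons j i k; rewrite ok => <-.
by have := alt_rcons i j k; rewrite (negbTE ok) => <-.
Qed.

Lemma ce_revK a : cox_eq m (rev a ++ a) [::].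
Proof.
elim: a => [|i a IH]; first exact: ce_refl.
rewrite rev_cons -cats1 -catA; apply: ce_trans IH.
exact: (ce_sq m (rev a) a i).
Qed.

(** Both relators have even length, so the parity of a word is the sign character of the group. *)
Lemma ce_parity a b : cox_eq m a b -> odd (size a) = odd (size b).
Proof.
elim=> {a b} [w|a b _ ->|a b e _ -> _ ->|a b i|a b i j nij] //.
- by rewrite !size_cat !oddD /=; case: odd; case: odd.
- by rewrite !size_cat !oddD size_alt oddM.
Qed.

Definition shortest w u : Prop :=
  cox_eq m w u /\ forall v, cox_eq m w v -> size u <= size v.

Definition canon w : seq 'I_n := epsilon (inhabits [::]) (shortest w).

Lemma canonP w : shortest w (canon w).
Proof.
apply: epsilon_spec.
have [k] : exists k, exists u, size u = k /\ cox_eq m w u.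
  by exists (size w), w; split=> //; exact: ce_refl.
elim/ltn_ind: k => k IH [u [su wu]].
case: (excluded_middle_informative
  (exists v, cox_eq m w v /\ size v < k)) => [[v [wv ltv]]|no].
  by apply: (IH _ ltv); exists v.
exists u; split=> // v wv; rewrite leqNgt; apply/negP => ltv.
by apply: no; exists v; rewrite -su.
Qed.

(** Equivalent words define the same predicate [shortest], and [epsilon] depends on nothing else;
    hence one chosen shortest word for each group element. *)
Lemma canon_ce w w' : cox_eq m w w' -> canon w = canon w'.
Proof.
move=> ww'; rewrite /canon; congr (epsilon _ _).
apply: functional_extensionality => u; apply: propositional_extensionality.
split=> -[h1 h2]; split.
- exact: ce_trans (ce_sym ww') h1.
- by move=> v wv; apply: h2; exact: ce_trans ww' wv.
- exact: ce_trans ww' h1.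
- by move=> v wv; apply: h2; exact: ce_trans (ce_sym ww') wv.
Qed.

Lemma canon_id w : canon (canon w) == canon w.
Proof. by apply/eqP/canon_ce/ce_sym; case: (canonP w). Qed.

End CoxeterWords.

(** With one word per group element, equality in the group is Leibniz equality and decidable, so
    duplicate-free lists of elements make sense. *)
Definition cox n m := {w : seq 'I_n | canon (m := m) w == w}.
HB.instance Definition _ n m := Countable.on (cox n m).

Section CoxeterGroup.

Context {n m : nat}.
Implicit Types (x y : cox n m) (a b w : seq 'I_n).

Definition mk w : cox n m := exist _ (canon (m := m) w) (canon_id w).

Lemma mk_eq a b : mk a = mk b <-> cox_eq m a b.
Proof.
split=> [[] h | h]; last by apply/val_inj; exact: canon_ce.
apply: ce_trans (ce_sym (canonP b).1); rewrite -h; exact: (canonP a).1.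
Qed.

Lemma mkK x : mk (val x) = x.
Proof. by apply: val_inj; exact/eqP/(valP x). Qed.

Lemma val_mk w : cox_eq m (val (mk w)) w.
Proof. by apply/mk_eq; rewrite mkK. Qed.

Definition cmul x y := mk (val x ++ val y).
Definition cinv x := mk (rev (val x)).

Lemma cmulA : associative cmul.
Proof.
move=> x y z; apply/mk_eq; apply: (ce_trans (w2 := val x ++ val y ++ val z)).
  by apply: ce_cat; [exact: ce_refl | exact: val_mk].
rewrite catA; apply: ce_sym; apply: ce_cat; [exact: val_mk | exact: ce_refl].
Qed.

Lemma cmul1 : left_id (mk [::]) cmul.
Proof.
move=> x; rewrite -{2}[x]mkK; apply/mk_eq.
by apply: (@ce_cat _ _ _ [::] _ (val x)); [exact: val_mk | exact: ce_refl].
Qed.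

Lemma cmulV : left_inverse (mk [::]) cinv cmul.
Proof.
move=> x; apply/mk_eq; apply: ce_trans (ce_revK (val x)).
by apply: ce_cat; [exact: val_mk | exact: ce_refl].
Qed.

Lemma cmulx1 : right_id (mk [::]) cmul.
Proof.
move=> x; rewrite -{2}[x]mkK; apply/mk_eq; rewrite -{2}[val x]cats0.
by apply: ce_cat; [exact: ce_refl | exact: val_mk].
Qed.

Lemma cmulxV : right_inverse (mk [::]) cinv cmul.
Proof.
move=> x; apply/mk_eq; apply: (ce_trans (w2 := val x ++ rev (val x))).
  by apply: ce_cat; [exact: ce_refl | exact: val_mk].
by have := @ce_revK n m (rev (val x)); rewrite revK.
Qed.

End CoxeterGroup.

HB.instance Definition _ n m := isGroup.Build (cox n m)
  cmulA cmul1 cmulx1 cmulV cmulxV.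

(** * Length, exchange and dihedral cosets *)

Section Length.

Local Open Scope group_scope.

Context {n m : nat}.
Implicit Types (x y u r : cox n m) (a b v w : seq 'I_n) (i j s t : 'I_n).

Definition gen s : cox n m := mk [:: s].
Definition altx i j k : cox n m := mk (alt i j k).
Definition len x := size (val x).
Definition desc x s := len (x * gen s) < len x.

Lemma mkM a b : mk (a ++ b) = mk a * mk b :> cox n m.
Proof.
by apply/mk_eq; apply: ce_sym; apply: ce_cat; exact: val_mk.
Qed.

Lemma mk_cons s a : mk (s :: a) = gen s * mk a :> cox n m.
Proof. by rewrite -mkM. Qed.

Lemma mk1 : mk [::] = 1 :> cox n m. Proof. by []. Qed.

Lemma mkV a : (mk a)^-1 = mk (rev a) :> cox n m.
Proof.
by apply/mulg1_eq; rewrite -mkM -mk1; apply/mk_eq; rewrite -{1}[a]revK; exact: ce_revK.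
Qed.

Lemma genV s : (gen s)^-1 = gen s. Proof. exact: mkV. Qed.

Lemma genK s : gen s * gen s = 1. Proof. by rewrite -{1}[gen s]genV mulVg. Qed.

Lemma mulgenK x s : x * gen s * gen s = x. Proof. by rewrite -mulgA genK mulg1. Qed.

Lemma len_mk a : len (mk a) <= size a.
Proof. by apply: (canonP a).2; exact: ce_refl. Qed.

Lemma len_parity a : odd (len (mk a)) = odd (size a).
Proof. by apply: (@ce_parity n m); exact: val_mk. Qed.

Lemma len1 : len 1 = 0.
Proof. by apply/eqP; rewrite -leqn0; exact: (len_mk [::]). Qed.

Lemma mulgenE x s : x * gen s = mk (rcons (val x) s).
Proof. by rewrite -cats1 mkM mkK. Qed.

Lemma len_genW x s : len (x * gen s) <= (len x).+1.
Proof. by rewrite mulgenE; have := len_mk (rcons (val x) s); rewrite size_rcons. Qed.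

Lemma odd_len_gen x s : odd (len (x * gen s)) = ~~ odd (len x).
Proof. by rewrite mulgenE len_parity size_rcons. Qed.

Lemma len_asc x s : ~~ desc x s -> len (x * gen s) = (len x).+1.
Proof.
rewrite /desc -leqNgt => h; apply/eqP; rewrite eqn_leq len_genW /= ltn_neqAle h andbT.
by apply/eqP => e; have := odd_len_gen x s; rewrite -e; case: odd.
Qed.

Lemma len_desc x s : desc x s -> len x = (len (x * gen s)).+1.
Proof.
move=> h; apply/eqP; rewrite eqn_leq; apply/andP; split=> //.
by have := len_genW (x * gen s) s; rewrite mulgenK.
Qed.

Lemma desc_gen x s : desc (x * gen s) s = ~~ desc x s.
Proof. by rewrite /desc mulgenK -leqNgt [RHS]leq_eqVlt; case: eqP => //= e;
  have := odd_len_gen x s; rewrite -e; case: odd. Qed.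

Lemma descN1 s : ~~ desc 1 s. Proof. by rewrite /desc len1. Qed.

Lemma altx0 i j : altx i j 0 = 1. Proof. by []. Qed.

Lemma altxS i j k : altx i j k.+1 = gen i * altx j i k.
Proof. by rewrite /altx /= mk_cons. Qed.

Lemma altx_rcons i j k :
  altx i j k.+1 = altx i j k * gen (if odd k then j else i).
Proof. by rewrite /altx alt_rcons -cats1 mkM. Qed.

Lemma altxD i j k l :
  altx i j (k + l) = altx i j k * (if odd k then altx j i l else altx i j l).
Proof. by rewrite /altx alt_cat mkM; case: odd. Qed.

Lemma altxV i j k : (altx i j k)^-1 = if odd k then altx i j k else altx j i k.
Proof. by rewrite /altx mkV rev_alt; case: odd. Qed.

Lemma altx_braid i j : i != j -> altx i j (2 * m) = 1.
Proof.
move=> nij; apply/mk_eq; have := ce_braid m [::] [::] nij.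
by rewrite /= cats0.
Qed.

Local Arguments Z.add : simpl never.
Local Arguments Z.sub : simpl never.
Local Arguments Z.opp : simpl never.
Local Arguments Z.of_nat : simpl never.

(* The letter [p] acts on the integers by [x |-> 1 - x] and every other letter
   by [x |-> - x]; modulo [m] this is a dihedral quotient of the group, which
   shows that no proper power of a product of two generators vanishes. *)
Definition dih_act (p : 'I_n) a (x : Z) : Z :=
  foldr (fun s z => if s == p then (1 - z)%Z else (- z)%Z) x a.

Lemma dih_act_alt p i j k (x : Z) : i != j -> dih_act p (alt i j (2 * k)) x =
  (x + (if i == p then 1 else if j == p then -1 else 0) * Z.of_nat k)%Z.
Proof.
move=> nij; elim: k => [|k IH]; first by rewrite /= /dih_act /=; lia.
rewrite mulnS /= IH.
case: (i =P p) nij => [->|_]; case: (j =P p) => [->|_]; rewrite ?eqxx // => _; try lia.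
Qed.

Lemma dih_act_ce p a b : cox_eq m a b -> forall x y : Z,
  (exists c, x = y + c * Z.of_nat m)%Z ->
  (exists c, dih_act p a x = dih_act p b y + c * Z.of_nat m)%Z.
Proof.
have act_cong w (x y : Z) : (exists c, x = y + c * Z.of_nat m)%Z ->
    (exists c, dih_act p w x = dih_act p w y + c * Z.of_nat m)%Z.
  move=> h; elim: w => //= s w [c ->].
  by exists (- c)%Z; case: eqP => _; lia.
have act_cat w1 w2 (x : Z) : dih_act p (w1 ++ w2) x = dih_act p w1 (dih_act p w2 x).
  by rewrite /dih_act foldr_cat.
elim=> {a b} [w|a b _ IH|a b e _ IH1 _ IH2|a b i|a b i j nij] x y h.
- exact: act_cong.
- have [|c hc] := IH y x; first by case: h => c ->; exists (- c)%Z; lia.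
  by exists (- c)%Z; lia.
- have [c1 ->] := IH1 _ _ h.
  have [|c2 ->] := IH2 y y; first by exists 0%Z; lia.
  by exists (c1 + c2)%Z; lia.
- rewrite !act_cat; apply: (act_cong a); have [c hc] := act_cong b _ _ h.
  by exists c; rewrite /= hc; case: eqP => _; lia.
- rewrite !act_cat; apply: (act_cong a); have [c hc] := act_cong b _ _ h.
  rewrite dih_act_alt //=; eexists (c + _)%Z.
  by rewrite hc Z.mul_add_distr_r Z.add_assoc.
Qed.

(** For [p = j] the word [alt i j (2 * k)] acts as translation by [-k], so [m] divides [k]. *)
Lemma altx_order i j k : i != j -> k < m -> altx i j (2 * k) = 1 -> k = 0.
Proof.
move=> nij km /mk_eq h.
have [|c] := dih_act_ce j h (x := 0%Z) (y := 0%Z); first by exists 0%Z.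
rewrite dih_act_alt // (negbTE nij) eqxx -[dih_act j [::] 0%Z]/0%Z => hc.
by case: (Z_lt_le_dec c 0) => hc0; nia.
Qed.

(* The reflections s_1 ... s_i ... s_1 of the word s_1 ... s_k.  The parity of the
   multiplicity of a reflection only depends on the element represented by the
   word; this yields the exchange condition. *)
Fixpoint refl a : seq (cox n m) :=
  if a is s :: a' then gen s :: [seq r ^ gen s | r <- refl a'] else [::].

Lemma refl_cat a b : refl (a ++ b) = refl a ++ [seq r ^ (mk a)^-1 | r <- refl b].
Proof.
elim: a => [|s a IH] /=.
  by rewrite mk1 invg1 -[LHS]map_id; apply: eq_map => t; rewrite conjg1.
rewrite IH map_cat -map_comp; congr (_ :: _ ++ _); apply: eq_map => r /=.
by rewrite mk_cons invgM genV conjgM.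
Qed.

Lemma refl_alt i j k : refl (alt i j k) = [seq altx i j (2 * l).+1 | l <- iota 0 k].
Proof.
elim: k i j => //= k IH i j; rewrite IH -[1%N]/(1 + 0)%N iotaDl -!map_comp.
congr (_ :: _); apply: eq_map => l /=.
rewrite conjgE genV mulgA -altxS; have -> : (2 * l.+1 = (2 * l).+2)%N by lia.
by rewrite [in RHS]altx_rcons /= oddM.
Qed.

Lemma count_conj (c t : cox n m) (L : seq (cox n m)) :
  count_mem t [seq r ^ c | r <- L] = count_mem (t ^ c^-1) L.
Proof.
rewrite count_map; apply: eq_count => r /=.
by apply/eqP/eqP => [<-|->]; rewrite ?conjgK // conjgKV.
Qed.

(** Inserting a relator conjugates the later reflections by 1 and adds its own reflections, each an
    even number of times: in the braid relator, positions [l] and [m + l] carry the same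
    reflection. *)
Lemma refl_odd a b : cox_eq m a b ->
  forall r, odd (count_mem r (refl a)) = odd (count_mem r (refl b)).
Proof.
have ctx a' c b' (t : cox n m) : mk c = 1 :> cox n m -> ~~ odd (count_mem (t ^ mk a') (refl c)) ->
    odd (count_mem t (refl (a' ++ c ++ b'))) = odd (count_mem t (refl (a' ++ b'))).
  move=> c1 hc; rewrite !refl_cat !count_cat !oddD; congr (_ (+) _).
  rewrite map_cat count_cat oddD count_conj invgK (negbTE hc) c1 invg1 /=.
  by rewrite -map_comp; congr (odd (count _ _)); apply: eq_map => r /=; rewrite conjg1.
elim=> {a b} [w|a b _ IH|a b e _ IH1 _ IH2|a b i|a b i j nij] t //.
- by rewrite IH1.
- apply: ctx; first by rewrite mk_cons genK.
  have -> : refl [:: i; i] = [:: gen i; gen i].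
    by rewrite /= conjgE genK mulg1 genV.
  by rewrite /=; case: eqP.
- apply: ctx; first exact: altx_braid.
  rewrite refl_alt mul2n -addnn iotaD map_cat count_cat add0n.
  have -> : iota m m = [seq (m + l)%N | l <- iota 0 m] by rewrite -iotaDl addn0.
  rewrite -map_comp (eq_map (f := _ \o _) (g := fun l => altx i j (2 * l).+1)) => [|l /=].
    by rewrite addnn odd_double.
  by rewrite mulnDr -addnS altxD altx_braid // oddM /= mul1g.
Qed.

(** Multiplying by the reflection at some position deletes the letter at that position. *)
Lemma refl_delete a r : r \in refl a ->
  exists2 a', size a' < size a & mk a' = r * mk a.
Proof.
elim: a r => //= s a IH r; rewrite inE => /orP[/eqP ->|/mapP[r0 /IH[a' sa' ea'] ->]].
  by exists a => //; rewrite mk_cons mulgA genK mul1g.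
exists (s :: a') => //; rewrite !mk_cons ea' conjgE genV.
by rewrite !mulgA mulgenK.
Qed.

(** Let [b] be a shortest word of [x * gen s]. The reflection [x s x^-1] occurs in [b s] as the last
    entry and nowhere else, since deleting a letter of [b] would spell [x] with fewer than [len x]
    letters; by parity it occurs in [a]. *)
Lemma exchange a s : desc (mk a) s -> gen s ^ (mk a)^-1 \in refl a.
Proof.
move=> ds; set x : cox n m := mk a; set b := val (x * gen s).
have eb : mk b = x * gen s by rewrite mkK.
have eab : cox_eq m a (b ++ [:: s]).
  by apply/mk_eq; rewrite mkM eb mulgenK.
have et : gen s ^ x^-1 = gen s ^ (mk b)^-1.
  rewrite eb invgM conjgM genV; congr (_ ^ _).
  by rewrite conjgE genK mulg1 genV.
have : odd (count_mem (gen s ^ x^-1) (refl a)).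
  rewrite (refl_odd eab) refl_cat count_cat et oddD /= eqxx /=.
  rewrite (count_memPn _) //; apply/negP => /refl_delete[a' sa' ea'].
  have : mk a' = x :> cox n m.
    by rewrite ea' conjgE invgK -!mulgA mulVg mulg1 eb mulgenK.
  move=> ea; have := len_mk a'; rewrite ea => /leq_ltn_trans /(_ sa').
  by rewrite ltnNge ltnW.
by case: (boolP (_ \in _)) => // /count_memPn ->.
Qed.

(** * Dihedral cosets, their bottoms and their tops *)

Lemma over_alt s t v : s != t -> 0 < m -> Defs.over [:: s; t] v ->
  exists2 k, k <= m & mk v = altx s t k \/ mk v = altx t s k.
Proof.
move=> nst m0; elim/last_ind: v => [|v p IH].
  by move=> _; exists 0 => //; left.
rewrite /Defs.over all_rcons => /andP[hp /IH[k km ek]].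
rewrite -cats1 mkM -/(gen p).
wlog : s t nst hp {IH} ek / mk v = altx s t k.
  move=> W; case: ek => ek; first by apply: (W s t) => //; left.
  have [|||k' k'm [e|e]] := W t s _ _ _ ek.
  - by rewrite eq_sym.
  - by move: hp; rewrite !inE orbC.
  - by left.
  - by exists k' => //; right.
  - by exists k' => //; left.
move=> {}ek; rewrite ek; case: (p =P (if odd k then t else s)) => hpk.
  rewrite hpk -altx_rcons; case: (ltngtP k m) km => // [km|km] _.
    by exists k.+1 => //; left.
  (* By the braid relation, the alternating word of length [m + 1] equals the one of length [m - 1]
     starting with the other letter. *)
  exists m.-1; first exact: leq_pred.
  right; have E : altx s t (2 * m) = 1 by apply: altx_braid.
  rewrite km; apply: (mulIg (if odd m.+1 then altx t s m.-1 else altx s t m.-1)).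
  rewrite -altxD; have -> : (m.+1 + m.-1 = 2 * m)%N by lia.
  rewrite E; have -> : odd m.+1 = odd m.-1 by rewrite -{1}(prednK m0) /= negbK.
  by rewrite -altxV mulgV.
case: k km ek hpk => [|k] km ek hpk.
  exists 1%N; first exact: m0.
  by rewrite altx0 mul1g; move: hp hpk; rewrite !inE => /orP[] /eqP -> //= _; right.
exists k; first exact: ltnW.
left; rewrite altx_rcons; have -> : p = if odd k then t else s.
  by move: hp hpk; rewrite !inE /=; case: odd => /orP[] /eqP ->.
by rewrite mulgenK.
Qed.

Lemma over_altw s t k : Defs.over [:: s; t] (alt s t k).
Proof.
suff : Defs.over [:: s; t] (alt s t k) && Defs.over [:: s; t] (alt t s k) by case/andP.
by elim: k => //= k /andP[h1 h2]; rewrite !inE !eqxx orbT h1 h2.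
Qed.

Definition min_in_coset s t u :=
  forall v, Defs.over [:: s; t] v -> len u <= len (u * mk v).

(** Each letter increases the length: otherwise [exchange] finds the new reflection either in [u],
    giving a shorter element of the coset, or at an earlier position [l < k], which [altx_order]
    excludes. *)
Lemma gate s t u k : s != t -> min_in_coset s t u -> k <= m ->
  len (u * altx s t k) = len u + k.
Proof.
move=> nst mu; elim: k => [|k IH] km; first by rewrite altx0 mulg1 addn0.
have {}IH := IH (ltnW km); set p := if odd k then t else s.
rewrite altx_rcons mulgA -/p addnS -IH; apply: len_asc; apply/negP => dp.
have E : u * altx s t k = mk (val u ++ alt s t k) by rewrite mkM mkK.
move: dp; rewrite E => /exchange; rewrite -E refl_cat mem_cat.
have conjE : gen p ^ (altx s t k)^-1 = altx s t (2 * k).+1.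
  rewrite conjgE invgK -/(altx s t k) mulgA -altx_rcons altxV.
  have := altxD s t k.+1 k; rewrite /= addSn addnn -mul2n => ->.
  by case: odd.
case/orP=> [/refl_delete[a' sa']|/mapP[r]].
  rewrite mkK invgM conjgM conjE conjgE invgK -!mulgA mulVg mulg1 => ea'.
  have := mu _ (over_altw s t (2 * k).+1); rewrite leqNgt -/(altx _ _ _) -ea'.
  by rewrite (leq_ltn_trans (len_mk _) sa').
rewrite refl_alt => /mapP[l]; rewrite mem_iota add0n => /andP[_ lk] ->.
rewrite mkK invgM conjgM conjE => /conjg_inj.
have -> : ((2 * k).+1 = (2 * l).+1 + 2 * (k - l))%N by lia.
rewrite altxD /= oddM /= -[X in _ = X -> _]mulg1 => /mulgI.
by move=> /altx_order; rewrite eq_sym => /(_ nst); lia.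
Qed.

Lemma over_swap s t v : Defs.over [:: s; t] v = Defs.over [:: t; s] v.
Proof. by apply: eq_all => p; rewrite !inE orbC. Qed.

Lemma min_in_coset_sym s t u : min_in_coset s t u -> min_in_coset t s u.
Proof. by move=> h v; rewrite over_swap => /h. Qed.

Lemma coset_min s t y : s != t -> 0 < m -> exists u k, [/\ min_in_coset s t u, k <= m
  & y = u * altx s t k \/ y = u * altx t s k].
Proof.
move=> nst m0.
have [k] : exists k, exists v, Defs.over [:: s; t] v /\ len (y * mk v) = k.
  by exists (len y), [::]; rewrite mk1 mulg1.
elim/ltn_ind: k => k IH [v [ov lv]].
case: (excluded_middle_informative
  (exists v', Defs.over [:: s; t] v' /\ len (y * mk v') < k)) => [[v' [ov' lv']]|no].
  by apply: (IH _ lv'); exists v'.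
have orv : Defs.over [:: s; t] (rev v) by rewrite /Defs.over all_rev.
have [l lm el] := over_alt nst m0 orv.
exists (y * mk v), l; split=> //.
  move=> v' ov'; rewrite lv leqNgt; apply/negP => lt; apply: no.
  by exists (v ++ v'); rewrite mkM mulgA; split=> //; rewrite /Defs.over all_cat; apply/andP.
by case: el => <-; rewrite -mkV mulgK; [left | right].
Qed.

(** Above the minimum of the coset, the last letter of the alternating word is a descent; so an
    element with neither descent is the minimum. *)
Lemma bottomP s t u : s != t -> 0 < m -> ~~ desc u s -> ~~ desc u t -> min_in_coset s t u.
Proof.
move=> nst m0 ds dt; have [u0 [k [mu0 km e]]] := coset_min u nst m0.
suff k0 : k = 0 by case: e; rewrite k0 altx0 mulg1 => ->.
case: k km e => // k km [] e.
- have : desc u (if odd k then t else s).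
    by rewrite /desc e [altx _ _ k.+1]altx_rcons mulgA mulgenK -mulgA -altx_rcons !gate // ?addnS // ltnW.
  by case: odd; apply/contraTeq; rewrite ?ds ?dt.
- have mu0' := min_in_coset_sym mu0; have nts : t != s by rewrite eq_sym.
  have : desc u (if odd k then s else t).
    by rewrite /desc e [altx _ _ k.+1]altx_rcons mulgA mulgenK -mulgA -altx_rcons !gate // ?addnS // ltnW.
  by case: odd; apply/contraTeq; rewrite ?ds ?dt.
Qed.

Lemma altx_mid i j : i != j -> altx i j m = altx j i m.
Proof.
move=> nij; apply: (mulIg (if odd m then altx j i m else altx i j m)).
by rewrite -altxD addnn -mul2n altx_braid // -altxV mulgV.
Qed.

(** At a position below [m] the next letter ascends by [gate], so [y] sits at position [m]; an
    alternating word read from there undoes the last letters of one of the two sides. *)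
Lemma topP s t y k : s != t -> 0 < m -> desc y s -> desc y t -> k <= m ->
  len (y * altx s t k) + k = len y.
Proof.
move=> nst m0 ds dt km; have nts : t != s by rewrite eq_sym.
have [u [l [mu lm e]]] := coset_min y nst m0; have mu' := min_in_coset_sym mu.
have top p q : p != q -> min_in_coset p q u -> desc y p -> desc y q ->
    y = u * altx p q l -> l = m.
  move=> npq mpq dp dq ey; apply/eqP; rewrite eqn_leq lm leqNgt /=; apply/negP => ltl.
  have : ~~ desc y (if odd l then q else p).
    by rewrite /desc ey -mulgA -altx_rcons (gate npq mpq ltl) (gate npq mpq lm) ltn_add2l ltnNge leqnSn.
  by case: odd; rewrite ?dp ?dq.
have {lm} l_m : l = m by case: e; [apply: top | apply: top].
have mid := altx_mid nst.
have {}e : y = u * altx s t m by case: e; rewrite l_m // mid.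
have key p q (j : nat) : altx p q (j + k) = altx p q j * (altx s t k)^-1 ->
    p != q -> min_in_coset p q u -> altx p q m = altx s t m -> (j + k)%N = m ->
    len (y * altx s t k) + k = len y.
  move=> E npq mpq Em jk.
  have jm : j <= m by rewrite -jk leq_addr.
  have E' : altx p q m * altx s t k = altx p q j by move: E; rewrite jk => ->; rewrite mulgVK.
  by rewrite e -Em -mulgA E' (gate npq mpq jm) (gate npq mpq (leqnn m)) -addnA jk.
have jk : (m - k + k)%N = m by rewrite subnK.
have := altxD s t (m - k) k; have := altxD t s (m - k) k; have := altxV s t k.
(* The parities of [k] and [m - k] decide which of the two alternating words of length [m] ends in
   the inverse of [altx s t k]. *)
case: (boolP (odd k)) => ok h0; case: (boolP (odd (m - k))) => om h1 h2.
- by apply: (key t s (m - k)%N); rewrite ?h0.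
- by apply: (key s t (m - k)%N); rewrite ?h0.
- by apply: (key s t (m - k)%N); rewrite ?h0.
- by apply: (key t s (m - k)%N); rewrite ?h0.
Qed.

End Length.

(** * Finite and unconditional sums of reals *)

Lemma Rplus_A : associative Rplus. Proof. by move=> x y z; lra. Qed.
Lemma Rplus_C : commutative Rplus. Proof. by move=> x y; lra. Qed.
Lemma Rplus_0 : left_id 0%Re Rplus. Proof. by move=> x; lra. Qed.
Lemma Rmult_0l : left_zero 0%Re Rmult. Proof. by move=> x; lra. Qed.
Lemma Rmult_0r : right_zero 0%Re Rmult. Proof. by move=> x; lra. Qed.
Lemma Rmult_Dl : left_distributive Rmult Rplus. Proof. by move=> x y z; lra. Qed.
Lemma Rmult_Dr : right_distributive Rmult Rplus. Proof. by move=> x y z; lra. Qed.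

HB.instance Definition _ := Monoid.isComLaw.Build R 0%Re Rplus Rplus_A Rplus_C Rplus_0.
HB.instance Definition _ := Monoid.isMulLaw.Build R 0%Re Rmult Rmult_0l Rmult_0r.
HB.instance Definition _ := Monoid.isAddLaw.Build R Rmult Rplus Rmult_Dl Rmult_Dr.

Notation "\rsum_ ( i <- r ) F" := (\big[Rplus/0%Re]_(i <- r) F%Re)
  (at level 41, F at level 41, i, r at level 50).
Notation "\rsum_ ( i <- r | P ) F" := (\big[Rplus/0%Re]_(i <- r | P%B) F%Re)
  (at level 41, F at level 41, i, r at level 50).
Notation "\rsum_ i F" := (\big[Rplus/0%Re]_i F%Re) (at level 41, F at level 41, i at level 0).
Notation "\rsum_ ( i | P ) F" := (\big[Rplus/0%Re]_(i | P%B) F%Re)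
  (at level 41, F at level 41, i at level 50).
Notation "\rsum_ ( a <= i < b ) F" := (\big[Rplus/0%Re]_(a <= i < b) F%Re)
  (at level 41, F at level 41, i, a, b at level 50).

Section FiniteSums.

Local Open Scope R_scope.

Lemma rsum_le_seq (I : eqType) (r : seq I) (P : pred I) (f g : I -> R) :
  (forall i, i \in r -> P i -> f i <= g i) -> \rsum_(i <- r | P i) f i <= \rsum_(i <- r | P i) g i.
Proof.
move=> h; rewrite big_seq_cond [X in _ <= X]big_seq_cond.
elim/big_rec2: _ => [|i a b /andP[hi Pi] hab]; first by lra.
by have := h i hi Pi; lra.
Qed.

Lemma rsum_le (I : Type) (r : seq I) (P : pred I) (f g : I -> R) :
  (forall i, P i -> f i <= g i) -> \rsum_(i <- r | P i) f i <= \rsum_(i <- r | P i) g i.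
Proof.
move=> h; elim/big_rec2: _ => [|i a b Pi hab]; first by lra.
by have := h i Pi; lra.
Qed.

Lemma rsum_ge0 (I : Type) (r : seq I) (P : pred I) (f : I -> R) :
  (forall i, P i -> 0 <= f i) -> 0 <= \rsum_(i <- r | P i) f i.
Proof.
move=> h; elim/big_rec: _ => [|i a Pi ha]; first by lra.
by have := h i Pi; lra.
Qed.

Lemma rsum_le_sub (I : Type) (r : seq I) (P Q : pred I) (f g : I -> R) :
  (forall i, P i -> Q i) -> (forall i, P i -> f i <= g i) -> (forall i, Q i -> 0 <= g i) ->
  \rsum_(i <- r | P i) f i <= \rsum_(i <- r | Q i) g i.
Proof.
move=> PQ fg g0; elim: r => [|x r IH]; first by rewrite !big_nil; lra.
rewrite !big_cons; case Px: (P x); first by rewrite (PQ _ Px); have := fg _ Px; lra.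
by case Qx: (Q x) => //; have := g0 _ Qx; lra.
Qed.

Lemma rsum_scale (I : Type) (r : seq I) (P : pred I) (c : R) (f : I -> R) :
  c * (\rsum_(i <- r | P i) f i) = \rsum_(i <- r | P i) (c * f i).
Proof. by rewrite big_distrr. Qed.

Lemma rsum_sub_seq (I : eqType) (r r' : seq I) (f : I -> R) :
  uniq r -> {subset r <= r'} -> (forall i, 0 <= f i) ->
  \rsum_(i <- r) f i <= \rsum_(i <- r') f i.
Proof.
move=> ur sr f0; elim: r ur r' sr => [|x r IH] /= ur r' sr.
  by rewrite big_nil; apply: rsum_ge0.
case/andP: ur => xr ur; have xr' : x \in r' by apply: sr; rewrite mem_head.
rewrite big_cons (perm_big _ (perm_to_rem xr')) /= big_cons.
apply: Rplus_le_compat_l; apply: IH => // y yr.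
have : y \in r' by apply: sr; rewrite inE yr orbT.
rewrite (perm_mem (perm_to_rem xr')) inE => /orP[/eqP yx|//].
by move: xr; rewrite -yx yr.
Qed.

Lemma rsum_sqr (I : Type) (r : seq I) (P : pred I) (f : I -> R) :
  (\rsum_(i <- r | P i) f i) ^ 2 <= INR (count P r) * (\rsum_(i <- r | P i) f i ^ 2).
Proof.
elim: r => [|x r IH]; first by rewrite !big_nil /=; lra.
rewrite !big_cons /=; case: (P x) => //; rewrite add1n S_INR.
move: IH; set S := \big[_/_]_(_ <- _ | _) f _; set Q := \big[_/_]_(_ <- _ | _) f _ ^ 2.
have : 0 <= INR (count P r) by apply: pos_INR.
have : 0 <= Q by apply: rsum_ge0 => i _; nra.
move: (INR _) => k Q0 k0 IH.
have : 2 * S * f x <= Q + k * f x ^ 2.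
  case: (Req_dec k 0) => [k00|kn]; first by rewrite k00 in IH *; nra.
  have kp : 0 < k by lra.
  apply: (Rmult_le_reg_l k) => //; have := pow2_ge_0 (S - k * f x); nra.
nra.
Qed.

Definition sum_bounded (T : eqType) (f : T -> R) (C : R) : Prop :=
  forall L : seq T, uniq L -> \rsum_(x <- L) f x <= C.

Lemma sum_lub (T : eqType) (f : T -> R) (C : R) : sum_bounded f C ->
  exists M, sum_bounded f M /\ forall M', sum_bounded f M' -> M <= M'.
Proof.
move=> h; pose E z := exists L : seq T, uniq L /\ z = \rsum_(x <- L) f x.
have [||M [M1 M2]] := completeness E.
- by exists C => z [L [uL ->]]; exact: h.
- by exists 0, [::]; rewrite big_nil.
exists M; split=> [L uL|M' hM']; first by apply: M1; exists L.
by apply: M2 => z [L [uL ->]]; exact: hM'.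
Qed.

End FiniteSums.

(** * The energy inequality seen from a base vertex *)

(* The factors of [len] may differ by the path taken in the group hierarchy,
   which [lia] does not see through. *)
Ltac len_lia :=
  repeat match goal with |- context [len ?x] => let l := fresh "l" in move: (len x) => l end;
  lia.

Section Descents.

Local Open Scope group_scope.

Context {n m : nat} (m3 : 3 <= m).
Implicit Types (x y u w : cox n m) (p q r s t : 'I_n).

Let m0 : 0 < m. Proof. exact: leq_trans m3. Qed.

(** Two descents put [y] at the top of its coset, from where an alternating word descends for
    [m >= 3] letters. *)
Lemma desc_pair y s t : s != t -> desc y s -> desc y t -> desc (y * gen s) t.
Proof.
move=> nst ds dt; have := topP nst m0 ds dt (k := 2).
rewrite altxS altxS altx0 mulg1 mulgA /desc => /(_ (ltnW m3)).
by have := len_desc ds; len_lia.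
Qed.

Lemma desc_triple y s t : s != t -> desc y s -> desc y t -> desc (y * gen s * gen t) s.
Proof.
move=> nst ds dt; have := topP nst m0 ds dt (k := 3) m3.
rewrite altxS altxS altxS altx0 mulg1 !mulgA /desc.
have d2 := desc_pair nst ds dt.
by have := len_desc ds; have := len_desc d2; len_lia.
Qed.

(* Such a [w] would yield the shorter element [w * gen t] with the same
   property for a permutation of [r, s, t]. *)
Lemma no_desc_chain w r s t : r != s -> r != t -> s != t ->
  desc w r -> desc w t -> desc (w * gen t) r -> desc (w * gen t) s -> False.
Proof.
move: {2}(len w) (leqnn (len w)) => k.
elim: k w r s t => [|k IH] w r s t lk nrs nrt nst dr dt dtr dts.
  by move: dr lk; rewrite /desc; len_lia.
apply: (IH (w * gen t) s t r) => //.
- by move: (len_desc dt) lk; len_lia.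
- by rewrite eq_sym.
- by rewrite eq_sym.
- by apply: desc_pair.
- by apply: desc_triple => //; rewrite eq_sym.
Qed.

Definition bottom u s t := ~~ desc u s && ~~ desc u t.

(* [y] is reached from the bottom of its coset of <p, q> by the alternating
   word of length [k] that ends with [q]. *)
Definition at_height k y p q := bottom (y * altx q p k) p q.

Lemma len_gateV u p q k : p != q -> bottom u p q -> k <= m ->
  len (u * (altx p q k)^-1) = (len u + k)%N /\ len (u * (altx q p k)^-1) = (len u + k)%N.
Proof.
move=> npq /andP[dp dq] km; have mu := bottomP npq m0 dp dq.
have mu' := min_in_coset_sym mu; have nqp : q != p by rewrite eq_sym.
by split; rewrite altxV; case: odd; rewrite gate.
Qed.

(** The starting letter of the remainder depends on a parity; only its length matters later, hence
    the unnamed pair. *)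
Lemma altx_drop i j k l : l <= k -> exists i' j', (i', j') \in [:: (i, j); (j, i)] /\
  (altx i j k)^-1 * altx i j l = (altx i' j' (k - l))^-1 :> cox n m.
Proof.
move=> lk; exists (if odd l then j else i), (if odd l then i else j); split.
  by case: odd; rewrite !inE eqxx ?orbT.
rewrite -[in LHS](subnKC lk) altxD invgM -mulgA.
by case: odd; rewrite mulVg mulg1.
Qed.

Lemma at_height_len k y p q l : p != q -> l <= k -> k <= m -> at_height k y p q ->
  len (y * altx q p l) = (len (y * altx q p k)%g + (k - l))%N.
Proof.
move=> npq lk km hb; have [i' [j' [hij E]]] := altx_drop q p lk.
have -> : y * altx q p l = y * altx q p k * (altx i' j' (k - l))^-1.
  by rewrite -E !mulgA mulgK.
have [h1 h2] := len_gateV npq hb (leq_trans (leq_subr l k) km).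
by move: hij; rewrite !inE => /orP[] /eqP [-> ->].
Qed.

(** The word read down from [y] descends for [k] letters, and since [k < m] there is still room to
    ascend along [p]. *)
Lemma at_height_desc k y p q : p != q -> 2 <= k < m -> at_height k y p q ->
  [/\ desc y q, desc (y * gen q) p, ~~ desc y p & 2 < k -> desc (y * gen q * gen p) q].
Proof.
move=> npq /andP[k2 km] hb; have km' := ltnW km.
have l0 := at_height_len npq (leq0n k) km' hb.
have l1 := at_height_len npq (ltnW k2) km' hb.
have l2 := at_height_len npq k2 km' hb.
rewrite altxS altx0 !mulg1 in l0 l1; rewrite !altxS altx0 mulg1 mulgA in l2.
split; rewrite /desc.
- by move: l0 l1; len_lia.
- by move: l1 l2; len_lia.
- have [h1 h2] := len_gateV npq hb km.
  have E : y * gen p = y * altx q p k * (altx p q k.+1)^-1.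
    by rewrite altxS invgM genV mulgA mulgK.
  by rewrite E; move: h1 l0; len_lia.
- move=> k3; have := at_height_len npq k3 km' hb.
  by rewrite !altxS altx0 mulg1 !mulgA; move: l2; len_lia.
Qed.

(** Past the bottom met after the smaller number of letters the word climbs again, whereas
    [at_height] for the larger number says that it still descends. *)
Lemma at_height_inj k l y p q : p != q -> k < m -> l < m ->
  at_height k y p q -> at_height l y p q -> k = l.
Proof.
wlog : k l / k <= l => [W npq km lm hk hl|kl npq km lm hk hl].
  by case: (leqP k l) => [/W->//|/ltnW/W<-].
have [dp dq] := andP hk; have mu := bottomP npq m0 dp dq.
have E : len (y * altx q p l) = (len (y * altx q p k)%g + (l - k))%N.
  have lkm : l - k <= m by rewrite (leq_trans (leq_subr k l)) // ltnW.
  rewrite -[in LHS](subnKC kl) altxD mulgA.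
  have nqp : q != p by rewrite eq_sym.
  by case: odd; [exact: gate | exact: gate nqp (min_in_coset_sym mu) lkm].
move: kl E; have := at_height_len npq (leq0n l) (ltnW lm) hl.
by have := at_height_len npq (leq0n k) (ltnW km) hk; len_lia.
Qed.

(** For [p != q] at most one [k] contributes, so the value is 0, 1 (for [k = 2]) or 2 (for
    [k >= 3]). *)
Definition weight y p q := (\sum_(2 <= k < m) at_height k y p q * (1 + (2 < k)))%N.

Lemma weightP y p q : p != q -> weight y p q = 0 \/
  [/\ weight y p q <= 2, desc y q, desc (y * gen q) p, ~~ desc y p
    & 1 < weight y p q -> desc (y * gen q * gen p) q].
Proof.
move=> npq; have [hex|hno] := boolP (has (fun k => at_height k y p q) (index_iota 2 m)).
  right; case/hasP: hex => k; rewrite mem_index_iota => kb hk.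
  have [d1 d2 d3 d4] := at_height_desc npq kb hk.
  have -> : weight y p q = 1 + (2 < k).
    rewrite /weight (bigD1_seq k) ?mem_index_iota ?iota_uniq //= hk mul1n.
    rewrite big1_seq ?addn0 // => l /andP[lk]; rewrite mem_index_iota => /andP[_ lm].
    case: (boolP (at_height l y p q)) => // hl; case/eqP: lk.
    by apply: at_height_inj hl hk; case/andP: kb.
  by split=> //; [case: (2 < k) | case: (ltnP 2 k) d4 => // _ d4 _; exact: d4].
left; rewrite /weight big1_seq // => k /andP[_ kb].
by have := hasPn hno k kb => /negbTE ->.
Qed.

(** The vertex lies strictly inside one side of a cell, so [p] ascends; another descent [r] would
    persist after [q] and give a chain excluded by [no_desc_chain]. *)
Lemma weight_asc y p q r : p != q -> 0 < weight y p q -> r != q -> ~~ desc y r.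
Proof.
move=> npq w0 nrq; case: (weightP y npq) w0 => [->//|[_ dq dqp dp _] _].
have [->//|nrp] := eqVneq r p; apply/negP => dr.
apply: (@no_desc_chain y r p q) => //.
by apply: desc_pair; rewrite // eq_sym.
Qed.

(** If both weights are positive, [p] and [r] are descents of [y * gen q]. A weight 2 would add the
    descent [q] one step further down, against [no_desc_chain]; so both weights are 1. *)
Lemma weight_sum y p r q : p != q -> r != q -> p != r -> weight y p q + weight y r q <= 2.
Proof.
move=> npq nrq npr.
case: (weightP y npq) => [->|[wp dq dqp dp d3]].
  by case: (weightP y nrq) => [->|[]].
case: (weightP y nrq) => [->|[wr _ dqr dr e3]]; first by rewrite addn0.
have aux a b : a != b -> a != q -> b != q -> desc (y * gen q) a -> desc (y * gen q) b ->
   desc (y * gen q * gen a) q -> False.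
  move=> nab naq nbq da db dab; apply: (@no_desc_chain (y * gen q) b q a) => //.
  - by rewrite eq_sym.
  - by rewrite eq_sym.
  - exact: desc_pair.
have w1 : weight y p q <= 1.
  by rewrite leqNgt; apply/negP => /d3; apply: (aux p r).
have w2 : weight y r q <= 1.
  by rewrite leqNgt; apply/negP => /e3; apply: (aux r p); rewrite // eq_sym.
by lia.
Qed.

End Descents.

(** * Unweighted cycles and left translation *)

Section Cycles.

Local Open Scope group_scope.

Context {n m : nat}.

(* [F s t x] is the value on the 2-cell x W_{st} oriented by the pair (s, t); the
   boundary signs are absorbed by the sign character of the group. *)
Definition is_cycle (F : 'I_n -> 'I_n -> cox n m -> R) : Prop :=
  [/\ forall s t x, F t s x = (- F s t x)%Re,
      forall s t x, F s t (x * gen s) = F s t x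
    & forall s x, \rsum_t F s t x = 0%Re].

(** The sum runs over vertices and ordered pairs, so it counts each cell [4 * m] times. *)
Definition l2_cycle (F : 'I_n -> 'I_n -> cox n m -> R) : Prop :=
  is_cycle F /\
  exists C, sum_bounded (fun x => \rsum_s \rsum_t (F s t x ^ 2))%Re C.

Lemma cycle_diag F s x : is_cycle F -> F s s x = 0%Re.
Proof. by case=> h _ _; have := h s s x; lra. Qed.

Lemma cycle_gen2 F s t x : is_cycle F -> F s t (x * gen t) = F s t x.
Proof. by case=> h1 h2 _; rewrite h1 h2 [RHS]h1. Qed.

Lemma cycle_alt F s t i j x k : is_cycle F -> (i, j) \in [:: (s, t); (t, s)] ->
  F s t (x * altx i j k) = F s t x.
Proof.
move=> hF; elim: k i j x => [|k IH] i j x hij; first by rewrite altx0 mulg1.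
rewrite altxS mulgA IH; last by move: hij; rewrite !inE => /orP[]/eqP[-> ->]; rewrite eqxx ?orbT.
move: hij; rewrite !inE => /orP[]/eqP[-> _]; last exact: cycle_gen2.
by case: hF.
Qed.

Lemma is_cycle_translate F g : is_cycle F -> is_cycle (fun s t x => F s t (g * x)).
Proof. by move=> [h1 h2 h3]; split=> [s t x|s t x|s x] //; rewrite mulgA h2. Qed.

Lemma cycle_translate F g : l2_cycle F -> l2_cycle (fun s t x => F s t (g * x)).
Proof.
move=> [hF [C hC]]; split; first exact: is_cycle_translate.
exists C => L uL; have := hC [seq g * x | x <- L].
by rewrite big_map map_inj_uniq; [apply | exact: mulgI].
Qed.

End Cycles.

(** * Energy estimates for a cycle *)

Section Rooted.

Local Open Scope group_scope.

Context {n m : nat} (m3 : 3 <= m) (F : 'I_n -> 'I_n -> cox n m -> R) (hF : is_cycle F).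
Implicit Types (x y u : cox n m) (p q r s t : 'I_n).

Local Open Scope R_scope.

Definition bottom_energy y := \rsum_p \rsum_(q | p != q) (INR (bottom y p q) * F p q y ^ 2).
Definition height_energy y := \rsum_p \rsum_(q | p != q) (INR (weight y p q) * F p q y ^ 2).

Lemma bottom_energy_ge0 y : 0 <= bottom_energy y.
Proof.
apply: rsum_ge0 => p _; apply: rsum_ge0 => q _.
by apply: Rmult_le_pos; [exact: pos_INR | nra].
Qed.

(** Cauchy-Schwarz for the cycle equation on the edge in direction [p], where [F p q y] is minus a
    sum of [n - 2] terms. *)
Lemma cycle_sqr_le y p q : p != q ->
  F p q y ^ 2 <= INR (n - 2) * (\rsum_(r | (p != r) && (r != q)) F p r y ^ 2).
Proof.
move=> npq.
have -> : F p q y = - (\rsum_(r | (p != r) && (r != q)) F p r y).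
  case: (hF) => _ _ /(_ p y); rewrite (bigD1 q) //= (bigD1 p) //= cycle_diag //.
  set S := \big[_/_]_(_ | _) _; set S' := \big[_/_]_(_ | _) _.
  have -> : S = S' by apply: eq_bigl => r; rewrite andbC eq_sym.
  by move=> ?; lra.
have := rsum_sqr (index_enum 'I_n) (fun r => (p != r) && (r != q)) (fun r => F p r y).
have -> : count (fun r => (p != r) && (r != q)) (index_enum 'I_n) = (n - 2)%N.
  have -> : count (fun r => (p != r) && (r != q)) (index_enum 'I_n) = #|~: [set p; q]|.
    rewrite cardE /enum_mem size_filter; apply: eq_count => r.
    by rewrite /= !inE negb_or eq_sym.
  by rewrite cardsCs setCK cards2 npq card_ord.
have sq (z : R) : (- z) ^ 2 = z ^ 2 by ring.
by rewrite sq.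
Qed.

Lemma height_energy1 : height_energy 1%g = 0.
Proof.
apply: big1 => p _; apply: big1 => q npq.
case: (weightP m3 1%g npq) => [->|[_ dq _ _ _]]; first by rewrite /=; lra.
by have := @descN1 n m q; rewrite dq.
Qed.

(** If some weight at [y] is positive, [y] has a single descent [t] and is the bottom of each of its
    cells avoiding [t]. Cauchy-Schwarz bounds the values on the cells [(p, t)] by those on the cells
    [(p, r)]. *)
Lemma height_energy_le y : height_energy y <= INR (n - 2) * bottom_energy y.
Proof.
have n0 := pos_INR (n - 2).
have [|no] := boolP [exists p, [exists q, (p != q) && (0 < weight y p q)%N]]; last first.
  rewrite [X in X <= _]big1 => [|p _]; first by have := bottom_energy_ge0 y; nra.
  rewrite big1 => // q npq; have := no; rewrite negb_exists => /forallP/(_ p).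
  rewrite negb_exists => /forallP/(_ q); rewrite npq /= -eqn0Ngt => /eqP ->.
  by rewrite /=; lra.
case/existsP=> p0 /existsP[t /andP[np0 w0]].
have asc r : r != t -> ~~ desc y r by apply: (weight_asc m3 np0 w0).
have dt : desc y t by case: (weightP m3 y np0) w0 => [->|[]].
have w0q p q : p != q -> q != t -> weight y p q = 0%N.
  move=> npq nqt; case: (weightP m3 y npq) => // -[_ dq _ _ _].
  by have := asc q nqt; rewrite dq.
have hE : height_energy y = \rsum_(p | p != t) (INR (weight y p t) * F p t y ^ 2).
  rewrite /height_energy (bigID (fun p => p != t)) /= [X in _ + X]big1 ?Rplus_0_r.
    apply: eq_bigr => p npt; rewrite (bigD1 t) //= big1 ?Rplus_0_r // => q /andP[npq nqt].
    by rewrite w0q //=; lra.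
  move=> p; rewrite negbK => /eqP ->; rewrite big1 // => q ntq.
  by rewrite w0q //=; [lra | rewrite eq_sym].
pose Q := \rsum_(p | p != t) \rsum_(r | (p != r) && (r != t)) (INR (weight y p t) * F p r y ^ 2).
have hQ : height_energy y <= INR (n - 2) * Q.
  rewrite hE /Q rsum_scale; apply: rsum_le => p npt; rewrite -rsum_scale.
  have h := Rmult_le_compat_l _ _ _ (pos_INR (weight y p t)) (cycle_sqr_le y npt).
  by apply: (Rle_trans _ _ _ h); right; rewrite -!Rmult_assoc [INR (n - 2) * _]Rmult_comm.
(* By antisymmetry of [F] the pairs [(p, r)] and [(r, p)] can exchange their weights; adding both
   forms of [Q] brings in [weight_sum]. *)
have Q2 : Q = \rsum_(p | p != t) \rsum_(r | (p != r) && (r != t)) (INR (weight y r t) * F p r y ^ 2).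
  rewrite /Q (exchange_big_dep (fun r => r != t)) /=; last by move=> p r _ /andP[].
  apply: eq_bigr => p npt; apply: eq_big => [r|r _].
    by rewrite npt andbT andbC eq_sym.
  by case: hF => -> _ _; nra.
have bE : \rsum_(p | p != t) \rsum_(r | (p != r) && (r != t)) (F p r y ^ 2) <= bottom_energy y.
  have pos p q : 0 <= INR (bottom y p q) * F p q y ^ 2.
    by apply: Rmult_le_pos; [exact: pos_INR | nra].
  apply: rsum_le_sub => // p => [npt|_]; last by apply: rsum_ge0.
  apply: rsum_le_sub => // r /andP[] // _ nrt.
  by rewrite /bottom !asc //=; lra.
suff : Q + Q <= 2 * bottom_energy y by nra.
rewrite {2}Q2 /Q -big_split /=.
apply: Rle_trans (_ : _ <= 2 * (\rsum_(p | p != t) \rsum_(r | (p != r) && (r != t)) (F p r y ^ 2))) _; last by lra.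
rewrite rsum_scale; apply: rsum_le => p npt; rewrite -big_split rsum_scale /=.
apply: rsum_le => r /andP[npr nrt].
have := weight_sum m3 y npt nrt npr => /leP/le_INR; rewrite plus_INR /= => h.
have := pow2_ge_0 (F p r y); nra.
Qed.

(** [F] is constant on each cell, so its value at the bottom can be read at the vertex [k] letters
    up one side. *)
Lemma bottom_transport k p q (L : seq (cox n m)) :
  \rsum_(u <- L) (INR (bottom u p q) * F p q u ^ 2) =
  \rsum_(y <- [seq (u * (altx q p k)^-1)%g | u <- L])
     (INR (at_height k y p q) * F p q y ^ 2).
Proof.
rewrite big_map; apply: eq_bigr => u _; rewrite /at_height mulgVK altxV.
by case: odd; rewrite (cycle_alt _ _ hF) // !inE eqxx ?orbT.
Qed.

Lemma sum_height_weights : (3 <= m)%N -> (\sum_(2 <= k < m) (1 + (2 < k)) = 2 * m - 5)%N.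
Proof.
elim: m => // k IH; rewrite leq_eqVlt => /orP[/eqP <-|k3]; first by rewrite unlock.
have k3' : (2 < k)%N by [].
by rewrite big_nat_recr ?(ltnW k3') //= IH // k3' /=; lia.
Qed.

(** Each cell is seen from its bottom and again at heights [2, ..., m - 1], with total weight
    [2 * m - 5] on each side; the two orders of the pair give the two sides. The identity can be
    discarded because its height energy is 0. *)
Lemma root_energy_bound (L : seq (cox n m)) : uniq L ->
  exists L', [/\ uniq L', 1%g \notin L' &
    INR (2 * m - 5) * (\rsum_(u <- L) bottom_energy u) <=
    INR (n - 2) * (\rsum_(y <- L') bottom_energy y)].
Proof.
move=> uL.
(* These are the displacements from a bottom to the vertices of its cell below height [m], so [L1]
   contains every vertex that is charged. *)
pose cs := [seq (altx a.1 a.2 k)^-1 | a <- enum {: 'I_n * 'I_n}, k <- iota 0 m] : seq (cox n m).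
pose L1 := undup [seq (u * c)%g | u <- L, c <- cs].
exists (rem 1%g L1); split.
- by rewrite rem_uniq ?undup_uniq.
- by rewrite mem_rem_uniq ?undup_uniq // !inE eqxx.
apply: Rle_trans (_ : _ <= \rsum_(y <- L1) height_energy y) _; last first.
  have [l1|l1] := boolP (1%g \in L1).
    rewrite (perm_big _ (perm_to_rem l1)) /= big_cons height_energy1 Rplus_0_l rsum_scale.
    by apply: rsum_le => y _; exact: height_energy_le.
  rewrite rem_id // rsum_scale.
  by apply: rsum_le => y _; exact: height_energy_le.
have -> : INR (2 * m - 5) = \rsum_(2 <= k < m) INR (1 + (2 < k)%N).
  rewrite -sum_height_weights //.
  by elim/big_rec2: _ => [|k a b _ <-] //; rewrite plus_INR.
rewrite big_distrl.
have -> : \rsum_(y <- L1) height_energy y = \rsum_(2 <= k < m) (INR (1 + (2 < k)%N) *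
    (\rsum_p \rsum_(q | p != q) \rsum_(y <- L1) (INR (at_height k y p q) * F p q y ^ 2))).
  under [RHS]eq_bigr => k _.
    rewrite rsum_scale.
    under eq_bigr => p _.
      rewrite rsum_scale; under eq_bigr => q _ do rewrite rsum_scale.
    over.
  over.
  rewrite /height_energy exchange_big [RHS]exchange_big /=; apply: eq_bigr => p _.
  rewrite exchange_big [RHS]exchange_big /=; apply: eq_bigr => q _.
  rewrite [RHS]exchange_big /=; apply: eq_bigr => y _.
  rewrite /weight.
  have -> : INR (\sum_(2 <= k < m) at_height k y p q * (1 + (2 < k)))%N =
      \rsum_(2 <= k < m) (INR (1 + (2 < k)%N) * INR (at_height k y p q)).
    by elim/big_rec2: _ => [|k a b _ <-] //; rewrite plus_INR mult_INR; lra.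
  rewrite big_distrl /=; apply: eq_bigr => k _; lra.
rewrite big_nat_cond [X in _ <= X]big_nat_cond.
apply: rsum_le => k; rewrite andbT => /andP[k2 km].
apply: Rmult_le_compat_l; first exact: pos_INR.
rewrite /bottom_energy exchange_big /=; apply: rsum_le => p _.
rewrite exchange_big /=; apply: rsum_le => q _.
rewrite (bottom_transport k); apply: rsum_sub_seq.
- by rewrite map_inj_uniq //; exact: mulIg.
- move=> y /mapP[u uLu ->]; rewrite mem_undup; apply: allpairs_f => //.
  apply/allpairsP; exists ((q, p), k); split=> //=; first by rewrite mem_enum.
  by rewrite mem_iota.
- by move=> y; apply: Rmult_le_pos; [exact: pos_INR | nra].
Qed.

End Rooted.

(** * Vanishing when [n - 2 <= 2 * m - 5] *)

Section RootedVanishing.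

Local Open Scope group_scope.

Context {n m : nat} (n3 : 3 <= n) (m3 : 3 <= m) (nm : n - 2 <= 2 * m - 5).

Local Open Scope R_scope.

Lemma rooted_cycle_vanishes (F : 'I_n -> 'I_n -> cox n m -> R) :
  l2_cycle F -> forall s t x, F s t x = 0.
Proof.
suff root (G : 'I_n -> 'I_n -> cox n m -> R) : l2_cycle G -> forall s t, G s t 1%g = 0.
  by move=> hF s t x; have := root _ (cycle_translate x hF) s t; rewrite mulg1.
move=> [hG [C hC]] s t.
have [|M [M1 M2]] := @sum_lub _ (bottom_energy G) C.
  move=> L uL; apply: Rle_trans (hC L uL); apply: rsum_le => y _.
  apply: rsum_le => p _; apply: rsum_le_sub => // q _; last by nra.
  by have := pow2_ge_0 (G p q y); case: bottom => /=; lra.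
have npos : 0 < INR (n - 2) by apply: lt_0_INR; lia.
have nmR : INR (n - 2) <= INR (2 * m - 5) by apply: le_INR; lia.
have M0 : 0 <= M by have := M1 [::] isT; rewrite big_nil.
(* [M] is the supremum of the finite sums of bottom energies; as the identity is not in [L'], its
   energy can be set aside from [M]. *)
have key : M <= INR (n - 2) * (M - bottom_energy G 1%g) / INR (2 * m - 5).
  apply: M2 => L uL; have [L' [uL' l1 hL]] := root_energy_bound m3 hG uL.
  have hM : bottom_energy G 1%g + (\rsum_(y <- L') bottom_energy G y) <= M.
    by have := M1 (1%g :: L'); rewrite /= l1 uL' big_cons => /(_ isT).
  apply: (Rmult_le_reg_r (INR (2 * m - 5))); first by lra.
  rewrite /Rdiv Rmult_assoc Rinv_l ?Rmult_1_r; last by lra.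
  move: hM hL; set SL' := \big[_/_]_(_ <- L') _; set SL := \big[_/_]_(_ <- L) _ => hM hL.
  have h2 : SL' <= M - bottom_energy G 1%g by lra.
  by have := Rmult_le_compat_l _ _ _ (Rlt_le _ _ npos) h2; lra.
have B0 : bottom_energy G 1%g <= 0.
  have := Rmult_le_compat_r (INR (2 * m - 5)) _ _ _ key.
  rewrite /Rdiv Rmult_assoc Rinv_l ?Rmult_1_r; last by lra.
  by move=> h; have := h ltac:(lra); nra.
have [->|nst] := eqVneq s t; first exact: cycle_diag.
have : G s t 1%g ^ 2 <= bottom_energy G 1%g.
  rewrite /bottom_energy (bigD1 s) //= (bigD1 t) //=.
  have -> : @bottom n m 1%g s t by rewrite /bottom !(@descN1 n m).
  set S := \big[_/_]_(_ | _) _; set S' := \big[_/_]_(_ | _) _.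
  have : 0 <= S by apply: rsum_ge0 => q _; apply: Rmult_le_pos; [exact: pos_INR | nra].
  have : 0 <= S'.
    apply: rsum_ge0 => p _; apply: rsum_ge0 => q _.
    by apply: Rmult_le_pos; [exact: pos_INR | nra].
  by rewrite [INR _]/=; lra.
nra.
Qed.

End RootedVanishing.

(** * Square-summable functions *)

Section UnconditionalSums.

Context {Y : eqType}.
Implicit Types (f g h : Y -> R).

Local Open Scope R_scope.

Definition summable f := (forall y, 0 <= f y) /\ exists C, sum_bounded f C.

(** The supremum of the finite partial sums, and an unspecified real if these are unbounded. *)
Definition ssum f := epsilon (inhabits 0)
  (fun M => sum_bounded f M /\ forall M', sum_bounded f M' -> M <= M').

Lemma ssumP f : summable f ->
  sum_bounded f (ssum f) /\ forall M', sum_bounded f M' -> ssum f <= M'.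
Proof. by case=> _ [C hC]; exact: (epsilon_spec (inhabits 0) _ (sum_lub hC)). Qed.

Lemma ssum_ge0 f : summable f -> 0 <= ssum f.
Proof. by move/ssumP=> [h _]; have := h [::] isT; rewrite big_nil. Qed.

Lemma ssum_ge f y : summable f -> f y <= ssum f.
Proof. by move/ssumP=> [h _]; have := h [:: y] isT; rewrite big_seq1. Qed.

Lemma ssum_le f g : summable f -> summable g -> (forall y, f y <= g y) -> ssum f <= ssum g.
Proof.
move=> hf hg fg; apply: (ssumP hf).2 => L uL; apply: Rle_trans ((ssumP hg).1 L uL).
exact: rsum_le.
Qed.

Lemma summableD f g : summable f -> summable g -> summable (fun y => f y + g y).
Proof.
move=> [f0 [C hC]] [g0 [D hD]]; split=> [y|]; first by have := f0 y; have := g0 y; lra.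
exists (C + D) => L uL; rewrite big_split /=.
by have := hC L uL; have := hD L uL; lra.
Qed.

Lemma summableZ c f : 0 <= c -> summable f -> summable (fun y => c * f y).
Proof.
move=> c0 [f0 [C hC]]; split=> [y|]; first exact: Rmult_le_pos.
by exists (c * C) => L uL; rewrite -rsum_scale; apply: Rmult_le_compat_l => //; exact: hC.
Qed.

Lemma summable_le f g : (forall y, 0 <= f y <= g y) -> summable g -> summable f.
Proof.
move=> fg [g0 [C hC]]; split=> [y|]; first by case: (fg y).
by exists C => L uL; apply: Rle_trans (hC L uL); apply: rsum_le => y _; case: (fg y).
Qed.

(** For the lower bound, finite lists for [f] and for [g] are merged into one, which can only
    increase both sums. *)
Lemma ssumD f g : summable f -> summable g -> ssum (fun y => f y + g y) = ssum f + ssum g.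
Proof.
move=> hf hg; have hfg := summableD hf hg; have [f0 _] := hf; have [g0 _] := hg.
apply: Rle_antisym.
  apply: (ssumP hfg).2 => L uL; rewrite big_split /=.
  by have := (ssumP hf).1 L uL; have := (ssumP hg).1 L uL; lra.
suff : ssum f <= ssum (fun y => f y + g y) - ssum g by lra.
apply: (ssumP hf).2 => L uL.
suff : ssum g <= ssum (fun y => f y + g y) - \rsum_(y <- L) f y by lra.
apply: (ssumP hg).2 => L' uL'.
have := (ssumP hfg).1 _ (undup_uniq (L ++ L')); rewrite big_split /=.
have : \rsum_(y <- L) f y <= \rsum_(y <- undup (L ++ L')) f y.
  by apply: rsum_sub_seq => // y yL; rewrite mem_undup mem_cat yL.
have : \rsum_(y <- L') g y <= \rsum_(y <- undup (L ++ L')) g y.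
  by apply: rsum_sub_seq => // y yL; rewrite mem_undup mem_cat yL orbT.
lra.
Qed.

Lemma ssumZ c f : 0 <= c -> summable f -> ssum (fun y => c * f y) = c * ssum f.
Proof.
move=> c0 hf; have hcf := summableZ c0 hf; apply: Rle_antisym.
  apply: (ssumP hcf).2 => L uL; rewrite -rsum_scale.
  by apply: Rmult_le_compat_l => //; exact: (ssumP hf).1.
case: (Req_dec c 0) => [->|cn]; first by rewrite Rmult_0_l; apply: ssum_ge0; apply: summableZ => //; lra.
have cp : 0 < c by lra.
apply: (Rmult_le_reg_l (/ c)); first exact: Rinv_0_lt_compat.
rewrite -Rmult_assoc Rinv_l // Rmult_1_l; apply: (ssumP hf).2 => L uL.
apply: (Rmult_le_reg_l c) => //; rewrite -Rmult_assoc Rinv_r // Rmult_1_l rsum_scale.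
exact: (ssumP hcf).1.
Qed.

End UnconditionalSums.

(** * The Hilbert space of square-summable functions *)

Section L2Space.

Context {Y : eqType}.

Local Open Scope R_scope.

Definition hs := {f : Y -> R | summable (fun y => f y ^ 2)}.
Definition hsf (f : hs) : Y -> R := proj1_sig f.
Coercion hsf : hs >-> Funclass.
Implicit Types (f g h : hs).

Lemma hsP f : summable (fun y => f y ^ 2). Proof. exact: (proj2_sig f). Qed.

Lemma hs_eq f g : (forall y, f y = g y) -> f = g.
Proof.
case: f g => f hf [g hg] /= /functional_extensionality fg.
have {}fg : f = g := fg.
by case: g / fg hg => hg; congr (exist _ _ _); exact: proof_irrelevance.
Qed.

Lemma lin_summable a b f g : summable (fun y => (a * f y + b * g y) ^ 2).
Proof.
apply: (@summable_le _ _ (fun y => 2 * a ^ 2 * f y ^ 2 + 2 * b ^ 2 * g y ^ 2)) => [y|].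
  split; first exact: pow2_ge_0.
  by have := pow2_ge_0 (a * f y - b * g y); nra.
by apply: summableD; apply: summableZ; try (by nra); exact: hsP.
Qed.

Definition vlin a b f g : hs := exist (fun f : Y -> R => summable (fun y => f y ^ 2)) 
  (fun y => a * f y + b * g y) (lin_summable a b f g).

Lemma vlinE a b f g y : vlin a b f g y = a * f y + b * g y. Proof. by []. Qed.

Definition vsub f g := vlin 1 (-1) f g.

Lemma vsubE f g y : vsub f g y = f y - g y. Proof. by rewrite vlinE; lra. Qed.

(** Polarization, so that only sums of nonnegative functions occur. *)
Definition ip f g := (ssum (fun y => (f y + g y) ^ 2) - ssum (fun y => (f y - g y) ^ 2)) / 4.

Lemma add_summable f g : summable (fun y => (f y + g y) ^ 2).
Proof.
have := lin_summable 1 1 f g; apply: summable_le => y; split; first exact: pow2_ge_0.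
by right; ring.
Qed.

Lemma sub_summable f g : summable (fun y => (f y - g y) ^ 2).
Proof.
have := lin_summable 1 (-1) f g; apply: summable_le => y; split; first exact: pow2_ge_0.
by right; ring.
Qed.

(** The inner product depends only on the pointwise product: moving the subtracted squares across
    leaves an equality between sums of nonnegative functions. Symmetry and additivity follow from
    this form. *)
Lemma ip_add_mul f g f1 g1 f2 g2 : (forall y, f y * g y = f1 y * g1 y + f2 y * g2 y) ->
  ip f g = ip f1 g1 + ip f2 g2.
Proof.
move=> E; rewrite /ip.
have : ssum (fun y => (f y + g y) ^ 2 + ((f1 y - g1 y) ^ 2 + (f2 y - g2 y) ^ 2)) =
       ssum (fun y => (f y - g y) ^ 2 + ((f1 y + g1 y) ^ 2 + (f2 y + g2 y) ^ 2)).
  by congr ssum; apply: functional_extensionality => y; have := E y; nra.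
have a1 := add_summable f g; have a2 := add_summable f1 g1; have a3 := add_summable f2 g2.
have b1 := sub_summable f g; have b2 := sub_summable f1 g1; have b3 := sub_summable f2 g2.
rewrite !ssumD //; try exact: summableD.
lra.
Qed.

Lemma ip0 f g : (forall y, f y * g y = 0) -> ip f g = 0.
Proof.
move=> E; have := @ip_add_mul f g f g f g; suff : (forall y, f y * g y = f y * g y + f y * g y).
  by move=> h /(_ h); lra.
by move=> y; rewrite E; lra.
Qed.

Lemma ip_mul f g f1 g1 : (forall y, f y * g y = f1 y * g1 y) -> ip f g = ip f1 g1.
Proof.
move=> E; pose z := vlin 0 0 f f.
rewrite (@ip_add_mul f g f1 g1 z z) => [|y]; last by rewrite E /z vlinE; ring.
by rewrite (@ip0 z z) ?Rplus_0_r // => y; rewrite vlinE; ring.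
Qed.

Lemma ipC f g : ip f g = ip g f.
Proof. by apply: ip_mul => y; ring. Qed.

Lemma ip_scale_mul c f g f1 g1 : (forall y, f y * g y = c * (f1 y * g1 y)) ->
  ip f g = c * ip f1 g1.
Proof.
(* [ssumZ] needs a nonnegative factor, so the sign of a negative [c] is absorbed into [f1]. *)
wlog : c f1 / 0 <= c => [W E|c0 E].
  case: (Rle_lt_dec 0 c) => [c0|cn]; first exact: W.
  rewrite (W (- c) (vlin (-1) 0 f1 f1)); try by lra.
    suff : ip (vlin (-1) 0 f1 f1) g1 + ip f1 g1 = 0 by nra.
    pose z := vlin 0 0 f f; rewrite -(@ip_add_mul z z); last by move=> y; rewrite !vlinE; ring.
    by apply: ip0 => y; rewrite vlinE; ring.
  by move=> y; rewrite vlinE E; ring.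
rewrite /ip.
have : ssum (fun y => (f y + g y) ^ 2 + c * (f1 y - g1 y) ^ 2) =
       ssum (fun y => (f y - g y) ^ 2 + c * (f1 y + g1 y) ^ 2).
  by congr ssum; apply: functional_extensionality => y; have := E y; nra.
have a1 := add_summable f g; have a2 := add_summable f1 g1.
have b1 := sub_summable f g; have b2 := sub_summable f1 g1.
rewrite !ssumD ?ssumZ //; try exact: summableZ.
lra.
Qed.

Lemma ip_linl a b f g h : ip (vlin a b f g) h = a * ip f h + b * ip g h.
Proof.
rewrite (@ip_add_mul _ h (vlin a 0 f f) h (vlin b 0 g g) h); last by move=> y; rewrite !vlinE; ring.
by congr (_ + _); apply: ip_scale_mul => y; rewrite vlinE; ring.
Qed.

Lemma ip_linr a b f g h : ip h (vlin a b f g) = a * ip h f + b * ip h g.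
Proof. by rewrite ipC ip_linl !(ipC h). Qed.

Lemma ip_subl f g h : ip (vsub f g) h = ip f h - ip g h.
Proof. by rewrite ip_linl; ring. Qed.

Lemma ip_subr f g h : ip h (vsub f g) = ip h f - ip h g.
Proof. by rewrite ip_linr; ring. Qed.

Definition nsq f := ip f f.

Lemma nsqE f : nsq f = ssum (fun y => f y ^ 2).
Proof.
rewrite /nsq /ip.
have -> : (fun y => (f y + f y) ^ 2) = (fun y => 4 * f y ^ 2).
  by apply: functional_extensionality => y; ring.
have -> : (fun y => (f y - f y) ^ 2) = (fun y => 0 * f y ^ 2).
  by apply: functional_extensionality => y; ring.
by rewrite !ssumZ; try lra; exact: hsP.
Qed.

Lemma nsq_ge0 f : 0 <= nsq f.
Proof. by rewrite nsqE; apply: ssum_ge0; exact: hsP. Qed.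

Lemma nsq_eval f y : f y ^ 2 <= nsq f.
Proof. by rewrite nsqE; exact: (ssum_ge y (hsP f)). Qed.

Lemma nsq_le f C : sum_bounded (fun y => f y ^ 2) C -> nsq f <= C.
Proof. by rewrite nsqE; apply: (ssumP (hsP f)).2. Qed.

Lemma nsq_bound f (L : seq Y) : uniq L -> \rsum_(y <- L) (f y ^ 2) <= nsq f.
Proof. by rewrite nsqE; apply: (ssumP (hsP f)).1. Qed.

Lemma nsq_sub f g : nsq (vsub f g) = nsq f - 2 * ip f g + nsq g.
Proof. by rewrite /nsq ip_subl !ip_subr (ipC g f); ring. Qed.

Lemma delta_bound x : sum_bounded (fun y : Y => (if y == x then 1 else 0) ^ 2) 1.
Proof.
move=> L uL; apply: Rle_trans (_ : _ <= \rsum_(y <- L | y == x) 1) _.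
  by right; rewrite [RHS]big_mkcond; apply: eq_bigr => y _; case: eqP => _; ring.
have [xL|xL] := boolP (x \in L).
  rewrite -big_filter (_ : [seq i <- L | i == x] = [:: x]) ?big_seq1; first by lra.
  by rewrite filter_pred1_uniq.
by rewrite big_seq_cond big_pred0 => [|y]; [lra | case: eqP => [->|]; rewrite ?(negbTE xL) ?andbF].
Qed.

Lemma delta_summable x : summable (fun y : Y => (if y == x then 1 else 0) ^ 2).
Proof. by split=> [y|]; [nra | exists 1; exact: delta_bound]. Qed.

Definition delta x : hs := exist (fun f : Y -> R => summable (fun y => f y ^ 2)) 
  (fun y => if y == x then 1 else 0) (delta_summable x).

Lemma deltaE x y : delta x y = if y == x then 1 else 0. Proof. by []. Qed.

Lemma nsq_delta x : nsq (delta x) = 1.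
Proof.
apply: Rle_antisym; first exact/nsq_le/delta_bound.
by have := nsq_eval (delta x) x; rewrite deltaE eqxx; lra.
Qed.

Lemma ip_delta f x : ip f (delta x) = f x.
Proof.
rewrite (@ip_scale_mul (f x) _ _ (delta x) (delta x)) -/(nsq _) ?nsq_delta ?Rmult_1_r // => y.
by rewrite deltaE; case: eqP => [->|_]; ring.
Qed.

End L2Space.
Arguments hs : clear implicits.

Section Restriction.

Context {Y : eqType} (B : pred Y).
Local Open Scope R_scope.
Implicit Types (f g : hs Y).

Lemma res_summable f : summable (fun y => (if B y then f y else 0) ^ 2).
Proof.
by have := hsP f; apply: summable_le => y; case: B; split; nra.
Qed.

Definition res f : hs Y := exist (fun f : Y -> R => summable (fun y => f y ^ 2)) 
  (fun y => if B y then f y else 0) (res_summable f).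

Lemma resE f y : res f y = if B y then f y else 0. Proof. by []. Qed.

Lemma ip_res f g : ip (res f) g = ip f (res g).
Proof. by apply: ip_mul => y; rewrite !resE; case: B; ring. Qed.

Lemma nsq_res f : ip f (res f) = nsq (res f).
Proof. by apply: ip_mul => y; rewrite !resE; case: B; ring. Qed.

Lemma nsq_res_le f : nsq (res f) <= nsq f.
Proof.
rewrite !nsqE; apply: ssum_le; try exact: hsP.
by move=> y; rewrite resE; case: B; nra.
Qed.

End Restriction.

(** * Orthogonal projections *)

Section Completeness.

Context {Y : eqType}.
Local Open Scope R_scope.
Implicit Types (f g h : hs Y) (u : nat -> hs Y).

Definition pcv u (f : Y -> R) := forall y, Un_cv (fun i => u i y) (f y).

Lemma cv_le (a : nat -> R) l C N :
  Un_cv a l -> (forall i, (N <= i)%N -> a i <= C) -> l <= C.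
Proof.
move=> al ha; case: (Rle_lt_dec l C) => // Cl; have [|N' hN'] := al (l - C); first by lra.
have := hN' (maxn N N') ltac:(lia); rewrite /R_dist => /Rabs_def2 [_ h].
by have := ha (maxn N N') (leq_maxl _ _); lra.
Qed.

Lemma cv_rsum (L : seq Y) (a : nat -> Y -> R) (l : Y -> R) :
  (forall y, Un_cv (fun i => a i y) (l y)) ->
  Un_cv (fun i => \rsum_(y <- L) a i y) (\rsum_(y <- L) l y).
Proof.
move=> h; elim: L => [|y L IH].
  by move=> e e0; exists 0%N => i _; rewrite !big_nil /R_dist Rminus_diag Rabs_R0.
rewrite big_cons; have := CV_plus _ _ _ _ (h y) IH.
by apply: Un_cv_ext => i; rewrite big_cons.
Qed.

Lemma cv_sqr_sub (a : nat -> R) (l c : R) :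
  Un_cv a l -> Un_cv (fun i => (c - a i) ^ 2) ((c - l) ^ 2).
Proof.
move=> al; have cc : Un_cv (fun _ => c) c.
  by move=> e e0; exists 0%N => i _; rewrite /R_dist Rminus_diag Rabs_R0.
have d := CV_minus _ _ _ _ cc al; have := CV_mult _ _ _ _ d d.
rewrite -[X in Un_cv _ X](_ : (c - l) ^ 2 = _); last by ring.
by apply: Un_cv_ext => i; ring.
Qed.

(** Every finite partial sum passes to the pointwise limit. *)
Lemma fatou u (f g : Y -> R) C N : pcv u f ->
  (forall i, (N <= i)%N -> sum_bounded (fun y => (g y - u i y) ^ 2) C) ->
  sum_bounded (fun y => (g y - f y) ^ 2) C.
Proof.
move=> uf h L uL; apply: (cv_le (N := N) (cv_rsum L (fun y => cv_sqr_sub (g y) (uf y)))) => i Ni.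
exact: h Ni _ uL.
Qed.

Lemma nsq_sub_le f g : nsq (vsub f g) <= 2 * nsq f + 2 * nsq g.
Proof.
have := nsq_ge0 (vlin 1 1 f g).
by rewrite nsq_sub /nsq ip_linl !ip_linr (ipC g f); lra.
Qed.

Definition hs_cauchy u := forall e, 0 < e -> exists N, forall i k,
  (N <= i)%N -> (N <= k)%N -> nsq (vsub (u i) (u k)) <= e.

Lemma hs_complete u : hs_cauchy u -> exists f : hs Y, pcv u f.
Proof.
move=> hc.
have cau y : Cauchy_crit (fun i => u i y).
  move=> e e0; have [|N hN] := hc ((e / 2) ^ 2); first by nra.
  exists N => i k Ni Nk; rewrite /R_dist.
  have := hN i k ltac:(lia) ltac:(lia); have := nsq_eval (vsub (u i) (u k)) y.
  by rewrite vsubE => h1 h2; apply: Rabs_def1; nra.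
pose f y := proj1_sig (R_complete _ (cau y)).
have uf : pcv u f by move=> y; exact: (proj2_sig (R_complete _ (cau y))).
suff hf : summable (fun y => f y ^ 2) by exists (exist _ f hf).
split=> [y|]; first exact: pow2_ge_0.
have [|N hN] := hc 1; first by lra.
exists (2 * nsq (u N) + 2 * 1) => L uL.
have := @fatou u f (fun _ => 0) (2 * nsq (u N) + 2 * 1) N uf.
move=> /(_ _ L uL) h; apply: Rle_trans (h _).
  by right; apply: eq_bigr => y _; ring.
move=> i Ni L' uL'; have -> : u i = vsub (u N) (vsub (u N) (u i)).
  by apply: hs_eq => y; rewrite !vsubE; ring.
apply: Rle_trans (_ : _ <= nsq (vsub (u N) (vsub (u N) (u i)))) _.
  apply: Rle_trans (nsq_bound _ uL'); right; apply: eq_bigr => y _; ring.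
apply: Rle_trans (nsq_sub_le _ _) _.
by have := hN N i (leqnn N) Ni; lra.
Qed.

End Completeness.

(** * Orthogonal projection onto a closed subspace *)

Section Projection.

Context {Y : eqType} (V : hs Y -> Prop).
Local Open Scope R_scope.
Implicit Types (f g h : hs Y) (u : nat -> hs Y).

(** Closure under pointwise limits implies closure in norm and is easy to check for subspaces cut
    out by local linear equations. *)
Definition closed_subspace :=
  [/\ exists f, V f, forall a b f g, V f -> V g -> V (vlin a b f g)
    & forall u f, (forall i, V (u i)) -> pcv u f -> V f].

Context (hV : closed_subspace).

(** A minimizing sequence for the distance to [V] is Cauchy by the parallelogram identity; its limit
    lies in [V], and minimality gives orthogonality. *)
Lemma proj_ex f : exists g, V g /\ forall h, V h -> ip (vsub f g) h = 0.
Proof.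
have [[f0 Vf0] Vlin Vcl] := hV.
(* [completeness] yields suprema, so the squared distances are negated. *)
pose E z := exists g, V g /\ z = - nsq (vsub f g).
have [||M [M1 M2]] := completeness E.
- by exists 0 => z [g [_ ->]]; have := nsq_ge0 (vsub f g); lra.
- by exists (- nsq (vsub f f0)), f0.
have lb g : V g -> - M <= nsq (vsub f g).
  move=> Vg; have : - nsq (vsub f g) <= M by apply: M1; exists g.
  by lra.
have ex k : exists g, V g /\ nsq (vsub f g) <= - M + / (INR k + 1).
  case: (excluded_middle_informative
    (exists g, V g /\ nsq (vsub f g) <= - M + / (INR k + 1))) => // no.
  have kp : 0 < / (INR k + 1) by apply: Rinv_0_lt_compat; have := pos_INR k; lra.
  suff : M <= M - / (INR k + 1) by lra.
  apply: M2 => z [g [Vg ->]]; case: (Rle_lt_dec (nsq (vsub f g)) (- M + / (INR k + 1))).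
    by move=> h; case: no; exists g.
  by lra.
pose g k := proj1_sig (constructive_indefinite_description _ (ex k)).
have [Vg hg] : (forall k, V (g k)) /\ forall k, nsq (vsub f (g k)) <= - M + / (INR k + 1).
  by split=> k; case: (proj2_sig (constructive_indefinite_description _ (ex k))).
have cau : hs_cauchy g.
  move=> e e0; have [N hN] := archimed_cor1 (e / 4) ltac:(lra).
  exists N => i k Ni Nk.
  have sm l : (N <= l)%N -> / (INR l + 1) <= e / 4.
    move=> Nl; apply: Rle_trans (_ : _ <= / INR N) _; last by lra.
    apply: Rinv_le_contravar; first by apply: lt_0_INR; case: hN.
    have : INR N <= INR l by apply: le_INR; apply/leP.
    by lra.
  have mid := lb _ (Vlin (/ 2) (/ 2) _ _ (Vg i) (Vg k)).
  have par : nsq (vsub (g i) (g k)) = 2 * nsq (vsub f (g i)) + 2 * nsq (vsub f (g k))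
             - 4 * nsq (vsub f (vlin (/ 2) (/ 2) (g i) (g k))).
    rewrite /nsq !ip_subl !ip_subr !ip_linl !ip_linr (ipC (g k) (g i)) (ipC (g k) f) (ipC (g i) f).
    by field.
  by have := hg i; have := hg k; have := sm i Ni; have := sm k Nk; lra.
have [g0 gg0] := hs_complete cau.
have Vg0 : V g0 := Vcl _ _ Vg gg0.
have min0 : nsq (vsub f g0) <= - M.
  apply: Rnot_lt_le => lt.
  have [N hN] := archimed_cor1 (nsq (vsub f g0) + M) ltac:(lra).
  suff : nsq (vsub f g0) <= - M + / INR N by lra.
  have Np : 0 < INR N by apply: lt_0_INR; case: hN.
  apply: nsq_le => L uL.
  have := @fatou _ g g0 f (- M + / INR N) N gg0 _ L uL => h.
  apply: Rle_trans (h _); first by right; apply: eq_bigr => y _; rewrite vsubE.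
  move=> i Ni L' uL'; apply: Rle_trans (_ : _ <= nsq (vsub f (g i))) _.
    by apply: Rle_trans (nsq_bound _ uL'); right; apply: eq_bigr => y _; rewrite vsubE.
  apply: Rle_trans (hg i) _; apply: Rplus_le_compat_l; apply: Rinv_le_contravar => //.
  have : INR N <= INR i by apply: le_INR; apply/leP.
  by lra.
exists g0; split=> // h Vh.
have [d dE] : exists d, d = vsub f g0 by exists (vsub f g0).
rewrite -dE in min0 *.
set a := ip _ _; pose b := nsq h; have b0 : 0 <= b := nsq_ge0 h.
(* The optimal coefficient would be [a / b]; [b + 1] avoids a division by zero. *)
have := lb _ (Vlin 1 (a / (b + 1)) _ _ Vg0 Vh).
have -> : vsub f (vlin 1 (a / (b + 1)) g0 h) = vlin 1 (- (a / (b + 1))) d h.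
  by apply: hs_eq => y; rewrite dE vsubE !vlinE; ring.
have -> : nsq (vlin 1 (- (a / (b + 1))) d h) =
    nsq d - 2 * (a / (b + 1)) * a + (a / (b + 1)) ^ 2 * b.
  by rewrite /b /nsq ip_linl !ip_linr (ipC h d) -/a; ring.
set c := a / (b + 1) => hc.
have ac : a = c * (b + 1) by rewrite /c; field; lra.
rewrite ac in hc *; have c0 : c ^ 2 * (b + 2) <= 0 by nra.
have : c ^ 2 <= 0 by nra.
move=> c2; have -> : c = 0 by nra.
by ring.
Qed.

Definition proj f : hs Y := proj1_sig (constructive_indefinite_description _ (proj_ex f)).

Lemma projP f : V (proj f) /\ forall h, V h -> ip (proj f) h = ip f h.
Proof.
rewrite /proj; case: constructive_indefinite_description => g /= [Vg hg]; split=> // h Vh.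
by have := hg h Vh; rewrite ip_subl; lra.
Qed.

Lemma nsq0 f : nsq f = 0 -> forall y, f y = 0.
Proof. by move=> f0 y; have := nsq_eval f y; rewrite f0; nra. Qed.

Lemma projU f g : V g -> (forall h, V h -> ip g h = ip f h) -> g = proj f.
Proof.
move=> Vg hg; have [Vp hp] := projP f; have [_ Vlin _] := hV.
have Vd : V (vsub g (proj f)) by exact: Vlin.
have : nsq (vsub g (proj f)) = 0 by rewrite /nsq ip_subl hg // hp //; ring.
by move/nsq0 => h; apply: hs_eq => y; have := h y; rewrite vsubE; lra.
Qed.

Lemma proj_sub f g : proj (vsub f g) = vsub (proj f) (proj g).
Proof.
have [Vf hf] := projP f; have [Vg hg] := projP g; have [_ Vlin _] := hV.
symmetry; apply: projU => [|h Vh]; first exact: Vlin.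
by rewrite !ip_subl hf // hg.
Qed.

Lemma ip_proj f g : V g -> ip g (proj f) = ip g f.
Proof. by move=> Vg; rewrite ipC (projP f).2 // ipC. Qed.

Lemma nsq_proj_le f : nsq (proj f) <= nsq f.
Proof.
have [Vf hf] := projP f; have := nsq_ge0 (vsub f (proj f)).
by rewrite nsq_sub -hf // -/(nsq _); lra.
Qed.

End Projection.

(** * The trace inequality *)

Lemma rsum_recr (f : nat -> R) j :
  \rsum_(0 <= l < j.+1) f l = (\rsum_(0 <= l < j) f l + f j)%Re.
Proof. by rewrite big_nat_recr. Qed.

Section AlternatingProjections.

Context {Y : eqType} {V : hs Y -> Prop} (hV : closed_subspace V) (B : pred Y).
Local Open Scope R_scope.
Implicit Types (f g h : hs Y) (x y b : Y).

(* [uu l x] is the kernel (P (1 - B P) ^ l)(x, -) where P is the projection onto V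
   and B the restriction to the subset [B]; it is symmetric in its two points. *)
Definition rstep f := vsub f (proj hV (res B f)).
Definition uu l x := iter l rstep (proj hV (delta x)).

Lemma rstepV f : V f -> V (rstep f).
Proof.
case: (hV) => _ Vlin _ Vf; apply: Vlin => //.
by case: (projP hV (res B f)).
Qed.

Lemma uuV l x : V (uu l x).
Proof.
elim: l => [|l IH] /=; first by case: (projP hV (delta x)).
exact: rstepV.
Qed.

Lemma ip_rstep f g : V f -> V g -> ip (rstep f) g = ip f (rstep g).
Proof.
move=> Vf Vg; rewrite ip_subl ip_subr (projP hV (res B f)).2 // ip_proj //.
by rewrite ip_res.
Qed.

(** [rstep] is self-adjoint on [V], so steps can be moved from one argument to the other. *)
Lemma ip_uu i k x y : ip (uu i x) (uu k y) = uu (i + k) x y.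
Proof.
elim: k i => [|k IH] i.
  by rewrite addn0 /= ip_proj ?ip_delta //; exact: uuV.
rewrite [uu k.+1 y]/= -ip_rstep; [|exact: uuV|exact: uuV].
by rewrite -[rstep _]/(uu i.+1 x) IH addSnnS.
Qed.

Lemma uuC l x y : uu l x y = uu l y x.
Proof. by rewrite -{1}[l]addn0 -ip_uu ipC ip_uu. Qed.

Lemma uu_even_step i x : uu (i + i) x x - uu (i + i).+1 x x = nsq (res B (uu i x)).
Proof.
rewrite -addnS -!ip_uu [uu i.+1 x]/= ip_subr ip_proj; last exact: uuV.
by rewrite nsq_res; ring.
Qed.

Lemma uu_odd_step i x : uu (i + i).+1 x x - uu (i + i).+2 x x =
  nsq (res B (uu i x)) - nsq (proj hV (res B (uu i x))).
Proof.
have -> : uu (i + i).+1 x x = ip (uu i.+1 x) (uu i x) by rewrite ip_uu addSn.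
have -> : uu (i + i).+2 x x = ip (uu i.+1 x) (uu i.+1 x) by rewrite ip_uu addSn addnS.
rewrite -ip_subr [in X in vsub _ X]/=.
have -> : vsub (uu i x) (rstep (uu i x)) = proj hV (res B (uu i x)).
  by apply: hs_eq => y; rewrite !vsubE; ring.
rewrite ip_proj; last exact: (uuV i.+1).
rewrite [uu i.+1 x]/= ip_subl nsq_res; congr (_ - _).
by rewrite -(ip_proj hV (res B (uu i x))) //; case: (projP hV (res B (uu i x))).
Qed.

(** The drop at an even index is a squared norm; at an odd index it is a squared norm minus that of
    a projection. *)
Lemma uu_dec l x : uu l.+1 x x <= uu l x x.
Proof.
rewrite -(odd_double_half l) -addnn; case: odd; rewrite ?add1n ?add0n.
  have := uu_odd_step l./2 x; have := nsq_proj_le hV (res B (uu l./2 x)); lra.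
by have := uu_even_step l./2 x; have := nsq_ge0 (res B (uu l./2 x)); lra.
Qed.

Lemma uu_ge0 l x : 0 <= uu l x x.
Proof.
apply: Rle_trans (_ : _ <= uu (l + l) x x) _.
  by rewrite -ip_uu; exact: nsq_ge0.
elim: {2}l => [|k IH]; first by rewrite addn0; lra.
by rewrite addnS; apply: Rle_trans IH; exact: uu_dec.
Qed.

Lemma nsq_uu l x : nsq (uu l x) = uu (l + l) x x. Proof. exact: ip_uu. Qed.

Lemma nsq_uuS l x : nsq (uu l x) <= nsq (uu l.+1 x) + 2 * nsq (res B (uu l x)).
Proof.
have -> : nsq (uu l.+1 x) = nsq (uu l x) - 2 * nsq (res B (uu l x))
   + nsq (proj hV (res B (uu l x))).
  by rewrite [uu l.+1 x]/= nsq_sub ip_proj ?nsq_res //; exact: uuV.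
by have := nsq_ge0 (proj hV (res B (uu l x))); lra.
Qed.

(** Telescopes [nsq_uuS], whose factor 2 is the cross term of an expanded square. *)
Lemma rho_le j x : uu 0 x x <= nsq (uu j x) + 2 * (\rsum_(0 <= l < j) nsq (res B (uu l x))).
Proof.
elim: j => [|j IH]; first by rewrite big_geq // nsq_uu addn0; lra.
by rewrite rsum_recr; have := nsq_uuS j x; lra.
Qed.

(** The iterates [v l] of [1 - B P] on [delta b] stay supported on [B] and project to [uu l b]; each
    step costs at least [nsq (uu l b)] of a squared norm that starts at 1. *)
Lemma sum_nsq_uu j b : B b -> \rsum_(0 <= l < j) nsq (uu l b) <= 1.
Proof.
move=> Bb; pose v l := iter l (fun f => vsub f (res B (proj hV f))) (delta b).
have vB l : res B (v l) = v l.
  elim: l => [|l IH] /=; apply: hs_eq => y.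
    by rewrite resE deltaE; case: eqP => [->|]; [rewrite Bb | case: B].
  move: (congr1 (fun f : hs Y => f y) IH); rewrite !resE !vsubE resE.
  by case: (B y) => // <-; ring.
have vu l : proj hV (v l) = uu l b.
  by elim: l => [|l IH] //=; rewrite proj_sub IH.
have vd l : nsq (v l.+1) + nsq (uu l b) <= nsq (v l).
  rewrite [v l.+1]/= nsq_sub -ip_res vB -vu.
  have -> : ip (v l) (proj hV (v l)) = nsq (proj hV (v l)).
    by rewrite ipC -(ip_proj hV (v l)) //; case: (projP hV (v l)).
  by have := nsq_res_le B (proj hV (v l)); lra.
suff : \rsum_(0 <= l < j) nsq (uu l b) + nsq (v j) <= 1 by have := nsq_ge0 (v j); lra.
elim: j => [|j IH]; first by rewrite big_geq //= nsq_delta; lra.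
by rewrite rsum_recr; have := vd j; lra.
Qed.

Context (detB : forall f, V f -> (forall y, B y -> f y = 0) -> forall y, f y = 0).

(** The diagonal values decrease to a limit, which makes [uu l x] Cauchy in [l]. The drops bound the
    values on [B], so the limit function vanishes on [B], hence everywhere by [detB]. *)
Lemma uu_cv0 x : Un_cv (fun l => uu l x x) 0.
Proof.
have [c0 hc0] : {l | Un_cv (fun l => uu l x x) l}.
  apply: decreasing_cv; first by move=> l; exact: uu_dec.
  by exists 0 => _ [l ->]; rewrite /opp_seq; have := uu_ge0 l x; lra.
have cau := CV_Cauchy _ (exist _ c0 hc0).
have hcau : hs_cauchy (uu^~ x).
  move=> e e0; have [N hN] := cau (e / 2) ltac:(lra).
  exists N => i k Ni Nk; rewrite nsq_sub !nsq_uu ip_uu.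
  have := hN (i + i)%N (i + k)%N ltac:(lia) ltac:(lia).
  have := hN (k + k)%N (i + k)%N ltac:(lia) ltac:(lia).
  by rewrite /R_dist => /Rabs_def2[h1 _] /Rabs_def2[h2 _]; lra.
have [f uf] := hs_complete hcau.
have Vf : V f by case: (hV) => _ _ Vcl; apply: Vcl uf => i; exact: uuV.
have fx : f x = 0.
  apply: detB => // b Bb.
  suff : f b ^ 2 <= 0 by nra.
  apply: Rnot_lt_le => fb.
  have [N hN] := cau (f b ^ 2 / 2) ltac:(lra).
  have /cv_le := cv_sqr_sub 0 (uf b) => /(_ (f b ^ 2 / 2) N) h.
  suff : (0 - f b) ^ 2 <= f b ^ 2 / 2 by nra.
  apply: h => i Ni.
  have := hN (i + i)%N (i + i).+1 ltac:(lia) ltac:(lia).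
  rewrite /R_dist uu_even_step => /Rabs_def2[h1 _].
  have := nsq_eval (res B (uu i x)) b; rewrite resE Bb.
  have -> : (0 - uu i x b) ^ 2 = uu i x b ^ 2 by ring.
  by lra.
by have := uf x; rewrite fx.
Qed.

End AlternatingProjections.

(** * Comparison of traces under a free group action *)

Section TraceInequality.

Context {Y : eqType} {V : hs Y -> Prop} (hV : closed_subspace V) (B : pred Y).
Context (detB : forall f : hs Y, V f -> (forall y, B y -> f y = 0%Re) -> forall y, f y = 0%Re).
Context {G : groupType} (act : G -> Y -> Y).
Context (actM : forall g h y, act (g * h)%g y = act g (act h y)) (act1 : forall y, act 1%g y = y).
Context (act_free : forall g y, act g y = y -> g = 1%g).

Local Open Scope R_scope.
Implicit Types (f : hs Y) (x y b : Y) (g : G).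

Lemma actK g : cancel (act g) (act g^-1).
Proof. by move=> y; rewrite -actM mulVg act1. Qed.

Lemma actVK g : cancel (act g^-1) (act g).
Proof. by move=> y; rewrite -actM mulgV act1. Qed.

Lemma trans_summable g f : summable (fun y => f (act g^-1 y) ^ 2).
Proof.
have [_ [C hC]] := hsP f; split=> [y|]; first exact: pow2_ge_0.
exists C => L uL; have := hC [seq act g^-1 y | y <- L].
by rewrite big_map map_inj_uniq; [apply | exact: can_inj (actVK g)].
Qed.

Definition trans g f : hs Y := exist (fun f : Y -> R => summable (fun y => f y ^ 2))
  (fun y => f (act g^-1 y)) (trans_summable g f).

Lemma transE g f y : trans g f y = f (act g^-1 y). Proof. by []. Qed.

Lemma transK g f : trans g (trans g^-1 f) = f.
Proof. by apply: hs_eq => y; rewrite !transE invgK actVK. Qed.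

Lemma trans_nsq g f : nsq (trans g f) = nsq f.
Proof.
have le g' f' : nsq (trans g' f') <= nsq f'.
  apply: nsq_le => L uL; have := nsq_bound f' (L := [seq act g'^-1 y | y <- L]).
  by rewrite big_map map_inj_uniq; [apply | exact: can_inj (actVK g')].
apply: Rle_antisym => //; rewrite -{1}[f](transK g^-1) invgK; exact: le.
Qed.

Lemma trans_sub g f f' : trans g (vsub f f') = vsub (trans g f) (trans g f').
Proof. by apply: hs_eq => y; rewrite transE !vsubE. Qed.

Lemma trans_ip g f f' : ip (trans g f) (trans g f') = ip f f'.
Proof.
have := nsq_sub (trans g f) (trans g f'); rewrite -trans_sub !trans_nsq nsq_sub; lra.
Qed.

Context (Vtrans : forall g f, V f -> V (trans g f)).

Lemma trans_proj g f : trans g (proj hV f) = proj hV (trans g f).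
Proof.
have [Vp hp] := projP hV f; apply: projU => [|h Vh]; first exact: Vtrans.
by rewrite -[h](transK g) !trans_ip hp //; exact: Vtrans.
Qed.

Lemma trans_delta g x : trans g (delta x) = delta (act g x).
Proof.
apply: hs_eq => y; rewrite transE !deltaE.
by rewrite -{2}[y](actVK g) (can_eq (actK g)).
Qed.

Lemma uu0_trans g x y : uu hV B 0 (act g x) (act g y) = uu hV B 0 x y.
Proof. by rewrite /uu /= -trans_delta -trans_proj transE actK. Qed.

Context (N : G -> Prop) (NM : forall g h, N g -> N h -> N (g * h)%g) (NV : forall g, N g -> N g^-1%g).
Context (NB : forall g y, N g -> B (act g y) = B y).

Lemma uu_trans g l x y : N g -> uu hV B l (act g x) (act g y) = uu hV B l x y.
Proof.
move=> Ng; suff -> : uu hV B l (act g x) = trans g (uu hV B l x) by rewrite transE actK.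
elim: l => [|l IH] /=; first by rewrite -trans_delta -trans_proj.
rewrite IH /rstep trans_sub trans_proj; congr (vsub _ (proj hV _)).
by apply: hs_eq => z; rewrite resE !transE resE NB //; exact: NV.
Qed.

Context (bs : seq Y) (ubs : uniq bs) (bsB : {in bs, forall b, B b}).
Context (bs_orbits : forall b, B b -> exists2 b0, b0 \in bs & exists2 g, N g & act g b0 = b).

Context (xs : seq Y) (uxs : uniq xs).
Context (xs_orbits : forall x x' g, x \in xs -> x' \in xs -> N g -> act g x = x' -> x = x').

(** Mass transport: by symmetry and [N]-invariance the entry at [(x, b)], with [b = g b0], equals
    the entry at [(b0, g^-1 x)]. Freeness and the distinct orbits of [xs] make the points [g^-1 x]
    distinct for fixed [b0], so each [b0] receives at most a full squared norm. *)
Lemma trace_swap l :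
  \rsum_(x <- xs) nsq (res B (uu hV B l x)) <= \rsum_(b <- bs) nsq (uu hV B l b).
Proof.
(* Each point of [B] gets a representative and a translating element; outside [B] the pair is a
   dummy. *)
have ex b : exists p : Y * G, B b -> [/\ p.1 \in bs, N p.2 & act p.2 p.1 = b].
  case Bb: (B b); last by exists (b, 1%g).
  by have [b0 h0 [g Ng e]] := bs_orbits Bb; exists (b0, g).
pose w b := proj1_sig (constructive_indefinite_description _ (ex b)).
have hw b : B b -> [/\ (w b).1 \in bs, N (w b).2 & act (w b).2 (w b).1 = b].
  exact: (proj2_sig (constructive_indefinite_description _ (ex b))).
pose F x y := (res B (uu hV B l x) y) ^ 2.
have sF x : summable (F x) := hsP _.
have sS (r : seq Y) : summable (fun y => \rsum_(x <- r) F x y) /\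
    ssum (fun y => \rsum_(x <- r) F x y) = \rsum_(x <- r) ssum (F x).
  elim: r => [|x r [h1 h2]].
    have z : summable (fun y : Y => \rsum_(x <- [::]) F x y).
      split=> [y|]; first by rewrite big_nil; lra.
      by exists 0 => L uL; rewrite big1 => [|y _]; rewrite ?big_nil //; lra.
    split=> //; rewrite big_nil; apply: Rle_antisym; last exact: ssum_ge0.
    by apply: (ssumP z).2 => L uL; rewrite big1 => [|y _]; rewrite ?big_nil //; lra.
  have -> : (fun y => \rsum_(x0 <- x :: r) F x0 y) = (fun y => F x y + \rsum_(x0 <- r) F x0 y).
    by apply: functional_extensionality => y; rewrite big_cons.
  by rewrite big_cons ssumD // h2; split=> //; exact: summableD.
have -> : \rsum_(x <- xs) nsq (res B (uu hV B l x)) = ssum (fun y => \rsum_(x <- xs) F x y).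
  by rewrite (sS xs).2; apply: eq_bigr => x _; rewrite nsqE.
apply: (ssumP (sS xs).1).2 => L uL.
pose LB := [seq b <- L | B b].
have -> : \rsum_(b <- L) \rsum_(x <- xs) F x b =
    \rsum_(b <- LB) \rsum_(x <- xs) (uu hV B l (w b).1 (act (w b).2^-1 x)) ^ 2.
  rewrite /LB big_filter [RHS]big_mkcond; apply: eq_bigr => b _.
  case Bb: (B b); last by rewrite big1 // => x _; rewrite /F resE Bb; ring.
  apply: eq_bigr => x _; rewrite /F resE Bb uuC; have [_ Ng e] := hw b Bb.
  by congr (_ ^ 2); rewrite -{1}e -{1}[x](actVK (w b).2) uu_trans.
have -> : \rsum_(b <- LB) \rsum_(x <- xs) (uu hV B l (w b).1 (act (w b).2^-1 x)) ^ 2 =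
  \rsum_(b0 <- bs) \rsum_(b <- LB | (w b).1 == b0) \rsum_(x <- xs)
     (uu hV B l b0 (act (w b).2^-1 x)) ^ 2.
  rewrite [RHS](exchange_big_dep predT) //= big_seq [RHS]big_seq; apply: eq_bigr => b.
  rewrite mem_filter => /andP[Bb _]; have [b0bs _ _] := hw b Bb.
  rewrite -[RHS]big_filter (_ : [seq b0 <- bs | (w b).1 == b0] = [:: (w b).1]) ?big_seq1 //.
  by rewrite -[RHS](filter_pred1_uniq ubs b0bs); apply: eq_filter => b0; rewrite eq_sym.
apply: rsum_le => b0 _; rewrite -big_filter.
set LB0 := [seq b <- LB | _].
apply: Rle_trans (_ : _ <= \rsum_(y <- [seq act (w b).2^-1%g x | b <- LB0, x <- xs])
    (uu hV B l b0 y ^ 2)) _; first by right; rewrite big_allpairs_dep.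
apply: nsq_bound; apply: allpairs_uniq => //; first by rewrite !filter_uniq.
move=> [b x] [b' x'] /allpairsP[[b1 x1] [/= hb1 hx1 [-> ->]]].
move=> /allpairsP[[b2 x2] [/= hb2 hx2 [-> ->]]].
move: hb1 hb2; rewrite !mem_filter => /and3P[/eqP e1 B1 _] /and3P[/eqP e2 B2 _] E.
have [_ N1 a1] := hw _ B1; have [_ N2 a2] := hw _ B2.
have E2 : act ((w b2).2 * (w b1).2^-1)%g x1 = x2 by rewrite actM E actVK.
have xx : x1 = x2 by apply: xs_orbits E2 => //; apply: NM => //; exact: NV.
have gg : ((w b2).2 * (w b1).2^-1)%g = 1%g by apply: (@act_free _ x1); rewrite E2 xx.
by rewrite xx -a1 -a2 e1 e2; congr (act _ _, _); apply/esym/divg1_eq.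
Qed.

(** The 1 bounds the remainder after [j] steps, for [j] large by [uu_cv0]; the other term of
    [rho_le] is moved by [trace_swap] to the representatives, where [sum_nsq_uu] allows 1 for
    each. *)
Lemma trace_bound rho : (forall x, x \in xs -> uu hV B 0 x x = rho) ->
  INR (size xs) * rho <= 1 + 2 * INR (size bs).
Proof.
move=> hrho.
have [j hj] : exists j, \rsum_(x <- xs) nsq (uu hV B j x) <= 1.
  suff [j hj] : exists j, forall i, (j <= i)%N -> \rsum_(x <- xs) nsq (uu hV B i x) <= 1.
    by exists j; apply: hj.
  have cv : Un_cv (fun i => \rsum_(x <- xs) uu hV B i x x) 0.
    have := cv_rsum xs (fun x => uu_cv0 hV (B := B) detB x).
    by rewrite big1.
  have [|N0 hN0] := cv 1; first by lra.
  exists N0 => i Ni; have := hN0 (i + i)%N ltac:(lia); rewrite /R_dist Rminus_0_r => /Rabs_def2[h _].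
  by apply: Rle_trans (Rlt_le _ _ h); right; apply: eq_bigr => x _; rewrite nsq_uu.
have -> : INR (size xs) * rho = \rsum_(x <- xs) uu hV B 0 x x.
  rewrite big_seq; under eq_bigr => x xxs do rewrite hrho //.
  rewrite -big_seq; elim: (xs) => [|x r IH]; first by rewrite big_nil /=; ring.
  by rewrite big_cons -IH [size _]/= S_INR; ring.
apply: Rle_trans (_ : _ <= \rsum_(x <- xs) (nsq (uu hV B j x) +
    2 * (\rsum_(0 <= l < j) nsq (res B (uu hV B l x))))) _.
  by apply: rsum_le => x _; exact: rho_le.
rewrite big_split /= -rsum_scale exchange_big /=.
suff : \rsum_(0 <= l < j) \rsum_(x <- xs) nsq (res B (uu hV B l x)) <= INR (size bs) by lra.
apply: Rle_trans (_ : _ <= \rsum_(0 <= l < j) \rsum_(b <- bs) nsq (uu hV B l b)) _.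
  by apply: rsum_le => l _; exact: trace_swap.
rewrite exchange_big /=.
apply: Rle_trans (_ : _ <= \rsum_(b <- bs) 1) _.
  by apply: rsum_le_seq => b hb _; apply: sum_nsq_uu; exact: bsB.
right; elim: (bs) => [|b r IH]; first by rewrite big_nil.
by rewrite big_cons IH -[size (b :: r)]/((size r).+1) S_INR Rplus_comm.
Qed.

End TraceInequality.

(** * Vanishing by a dimension count *)

Section TraceVanishing.

Context {Y : eqType} {V : hs Y -> Prop} (hV : closed_subspace V) (B : pred Y).
Context (detB : forall f : hs Y, V f -> (forall y, B y -> f y = 0%Re) -> forall y, f y = 0%Re).
Context {G : groupType} (act : G -> Y -> Y).
Context (actM : forall g h y, act (g * h)%g y = act g (act h y)) (act1 : forall y, act 1%g y = y).
Context (act_free : forall g y, act g y = y -> g = 1%g).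
Context (Vtrans : forall g (f f' : hs Y), V f -> (forall y, f' y = f (act g y)) -> V f').
Context (N : G -> Prop) (N1 : N 1%g).
Context (NM : forall g h, N g -> N h -> N (g * h)%g) (NV : forall g, N g -> N g^-1%g).
Context (NB : forall g y, N g -> B (act g y) = B y).
Context (K : finType) (kappa : Y -> K).
Context (kappaP : forall b b', B b -> B b' -> kappa b = kappa b' -> exists2 g, N g & act g b = b').

Local Open Scope R_scope.

(* A von Neumann dimension count: the evaluations at infinitely many points in
   distinct [N]-orbits have the same norm [rho] on [V], while [V] embeds in the
   functions on [B], which has finitely many [N]-orbits; so [rho = 0]. *)
Theorem trace_vanishing (x0 : Y) (gs : nat -> G) :
  (forall i k g, N g -> act g (act (gs i) x0) = act (gs k) x0 -> i = k) ->
  forall f : hs Y, V f -> f x0 = 0.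
Proof.
move=> hgs f Vf.
have Vt g f' : V f' -> V (trans actM act1 g f').
  by move=> Vf'; apply: (Vtrans (g := g^-1%g) Vf') => y; rewrite transE.
(* One point of [B] for each value of [kappa]; for a value not taken on [B] the choice is arbitrary,
   so [bs] is filtered by [B]. *)
pose rep k := epsilon (inhabits x0) (fun b => B b /\ kappa b = k).
pose bs := [seq b <- undup [seq rep k | k : K] | B b].
have ubs : uniq bs by rewrite filter_uniq ?undup_uniq.
have bsB : {in bs, forall b, B b} by move=> b; rewrite mem_filter => /andP[].
have bso b : B b -> exists2 b0, b0 \in bs & exists2 g, N g & act g b0 = b.
  move=> Bb; have [Br kr] : B (rep (kappa b)) /\ kappa (rep (kappa b)) = kappa b.
    by apply: (epsilon_spec (inhabits x0) (fun b' => B b' /\ kappa b' = kappa b)); exists b.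
  exists (rep (kappa b)); last exact: kappaP.
  by rewrite mem_filter Br mem_undup; apply/mapP; exists (kappa b); rewrite ?mem_enum.
set rho := uu hV B 0 x0 x0.
have key M : INR M * rho <= 1 + 2 * INR (size bs).
  pose xs := [seq act (gs i) x0 | i <- iota 0 M].
  have xso x x' g : x \in xs -> x' \in xs -> N g -> act g x = x' -> x = x'.
    by move=> /mapP[i _ ->] /mapP[k _ ->] Ng /hgs-/(_ Ng) ->.
  have uxs : uniq xs.
    by rewrite map_inj_uniq ?iota_uniq // => i k E; apply: (hgs _ _ _ N1); rewrite act1.
  have := trace_bound (hV := hV) detB act_free Vt NM NV NB ubs bsB bso uxs xso (rho := rho).
  rewrite size_map size_iota; apply=> x /mapP[i _ ->].
  exact: (uu0_trans _ _ Vt).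
have rho_nsq : nsq (uu hV B 0 x0) = rho by rewrite nsq_uu.
have rho0 : rho = 0.
  apply: Rle_antisym; last by rewrite -rho_nsq; exact: nsq_ge0.
  apply: Rnot_lt_le => rp; have [M hM] := INR_unbounded ((1 + 2 * INR (size bs)) / rho).
  have := Rmult_lt_compat_r _ _ _ rp hM; rewrite /Rdiv Rmult_assoc Rinv_l; last by lra.
  by have := key M; lra.
(* [uu hV B 0 x0] is the reproducing kernel of [V] at [x0], and its squared norm is [rho]. *)
have <- : ip f (uu hV B 0 x0) = f x0 by rewrite /= ip_proj // ip_delta.
rewrite rho0 in rho_nsq; apply: ip0 => y.
by rewrite (nsq0 rho_nsq); ring.
Qed.

End TraceVanishing.

(** * The exceptional case n = 4, m = 3 *)

(* For n = 4 and m = 3 every edge of the Cayley graph gets a direction, up or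
   down, such that each vertex has two ascending and two descending edges and
   the resulting height is well defined.  The six labels 0, ..., 5 are the
   possible sets {0,1}, {0,2}, {0,3}, {1,2}, {1,3}, {2,3} of descending
   generators at a vertex; this is the fibration over the circle of the
   regular ideal tetrahedra tiling of hyperbolic 3-space. *)
Definition fib_next (l s : nat) : nat := (nth 0 (nth [::]
  [:: [:: 3; 2; 1; 4]; [:: 5; 3; 0; 2]; [:: 4; 0; 5; 1];
      [:: 0; 1; 4; 5]; [:: 2; 5; 3; 0]; [:: 1; 4; 2; 3]] l) s)%N.

Definition fib_up (l s : nat) : bool := s \notin nth [::]
  [:: [:: 0; 1]; [:: 0; 2]; [:: 0; 3]; [:: 1; 2]; [:: 1; 3]; [:: 2; 3]]%N l.

Definition fib_step (p : nat * Z) (s : nat) : nat * Z :=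
  (fib_next p.1 s, if fib_up p.1 s then (p.2 + 1)%Z else (p.2 - 1)%Z).

Lemma fib_step_lt p s : p.1 < 6 -> s < 4 -> (fib_step p s).1 < 6.
Proof.
by case: p => -[|[|[|[|[|[|l]]]]]] z // _; case: s => [|[|[|[|s]]]].
Qed.

(** A finite check: around each hexagon the label returns, and three steps up balance three steps
    down. *)
Lemma fib_step_braid p s t : p.1 < 6 -> s < 4 -> t < 4 -> s != t ->
  foldl fib_step p [:: s; t; s; t; s; t] = p.
Proof.
case: p => -[|[|[|[|[|[|l]]]]]] z // _; case: s => [|[|[|[|s]]]] // _;
case: t => [|[|[|[|t]]]] // _ _; rewrite /= /fib_step /=; congr (_, _); ring.
Qed.

Lemma fib_step_sq p s : p.1 < 6 -> s < 4 -> foldl fib_step p [:: s; s] = p.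
Proof.
case: p => -[|[|[|[|[|[|l]]]]]] z // _; case: s => [|[|[|[|s]]]] // _;
rewrite /= /fib_step /=; congr (_, _); ring.
Qed.

Lemma fib_two_two l c d t : l < 6 -> c < 4 -> d < 4 -> t < 4 -> c != d -> t != c -> t != d ->
  fib_up l c = fib_up l d -> fib_up l t = ~~ fib_up l c.
Proof.
by case: l => [|[|[|[|[|[|l]]]]]] // _; case: c => [|[|[|[|c]]]] // _;
case: d => [|[|[|[|d]]]] // _; case: t => [|[|[|[|t]]]].
Qed.

Lemma fib_has_up l : l < 6 -> exists s : 'I_4, fib_up l s.
Proof.
case: l => [|[|[|[|[|[|l]]]]]] // _.
- by exists (Ordinal (isT : 2 < 4)).
- by exists (Ordinal (isT : 1 < 4)).
- by exists (Ordinal (isT : 1 < 4)).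
- by exists (Ordinal (isT : 0 < 4)).
- by exists (Ordinal (isT : 0 < 4)).
- by exists (Ordinal (isT : 0 < 4)).
Qed.

Section Fibration.

Local Open Scope group_scope.

Local Notation X := (cox 4 3).
Implicit Types (x y g : X) (w : seq 'I_4) (s t : 'I_4).

Definition fib_run w (p : nat * Z) := foldl fib_step p [seq val s | s <- w].

Lemma fib_run_cat w1 w2 p : fib_run (w1 ++ w2) p = fib_run w2 (fib_run w1 p).
Proof. by rewrite /fib_run map_cat foldl_cat. Qed.

Lemma fib_run_lt w p : p.1 < 6 -> (fib_run w p).1 < 6.
Proof. by elim: w p => //= s w IH p hp; exact: (IH _ (fib_step_lt hp (ltn_ord s))). Qed.

Lemma fib_run_ce w1 w2 : cox_eq 3 w1 w2 -> forall p, p.1 < 6 -> fib_run w1 p = fib_run w2 p.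
Proof.
elim=> {w1 w2} [w|a b _ IH|a b e _ IH1 _ IH2|a b i|a b i j nij] p hp //.
- by rewrite IH.
- by rewrite IH1 ?IH2.
- rewrite !fib_run_cat; congr (fib_run b _).
  exact: (fib_step_sq (fib_run_lt a hp) (ltn_ord i)).
- rewrite !fib_run_cat; congr (fib_run b _).
  exact: (fib_step_braid (fib_run_lt a hp) (ltn_ord i) (ltn_ord j) nij).
Qed.

Lemma fib_run_shift w l (z c : Z) : fib_run w (l, (z + c)%Z) =
  ((fib_run w (l, z)).1, ((fib_run w (l, z)).2 + c)%Z).
Proof.
elim: w l z => //= s w IH l z; rewrite /fib_run /= -!/(fib_run w _) /fib_step /=.
by rewrite -IH; congr (fib_run w (_, _)); case: fib_up; ring.
Qed.

Definition fib x := fib_run (val x) (0, 0%Z).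
Definition lab x := (fib x).1.
Definition hgt x := (fib x).2.

Lemma fib_mk w : fib (mk w) = fib_run w (0, 0%Z).
Proof. by apply: fib_run_ce => //; exact: val_mk. Qed.

Lemma fib1 : fib 1 = (0, 0%Z). Proof. exact: (fib_mk [::]). Qed.

Lemma fibM x y : fib (x * y) = fib_run (val y) (fib x).
Proof. by rewrite -fib_run_cat; exact: fib_mk. Qed.

Lemma fib_gen x s : fib (x * gen s) = fib_step (fib x) s.
Proof. by rewrite mulgenE fib_mk -cats1 fib_run_cat. Qed.

Lemma lab_lt x : lab x < 6. Proof. exact: fib_run_lt. Qed.

Lemma hgt_gen x s : hgt (x * gen s) = if fib_up (lab x) s then (hgt x + 1)%Z else (hgt x - 1)%Z.
Proof. by rewrite /hgt fib_gen. Qed.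

(** Labels evolve independently of the height, so an element of label 0 keeps labels and shifts all
    heights. *)
Lemma fib_translate g x : lab g = 0%N -> fib (g * x) = (lab x, (hgt x + hgt g)%Z).
Proof.
move=> g0; rewrite fibM; have -> : fib g = (0%N, (0 + hgt g)%Z).
  by rewrite -g0 Z.add_0_l -surjective_pairing.
by rewrite fib_run_shift.
Qed.

(** Left translation by these elements preserves label and height, and has at most six orbits on the
    vertices of height 0, one for each label. *)
Definition fib_ker g : Prop := fib g = (0%N, 0%Z).

Lemma fib_kerP g x : fib_ker g -> fib (g * x) = fib x.
Proof.
move=> g0; rewrite fib_translate /lab ?g0 // /hgt g0 Z.add_0_r.
by rewrite -surjective_pairing.
Qed.

Lemma fib_kerV g : fib_ker g -> fib_ker g^-1.
Proof. by move=> g0; rewrite /fib_ker -(fib_kerP _ g0) mulgV fib1. Qed.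

Lemma fib_ker_div x y : fib x = fib y -> fib_ker (y / x).
Proof. by move=> e; rewrite /fib_ker fibM -e -fibM mulgV fib1. Qed.

Lemma height_surj (k : nat) : exists x, hgt x = Z.of_nat k.
Proof.
elim: k => [|k [x hx]]; first by exists 1; rewrite /hgt fib1.
have [s us] := fib_has_up (lab_lt x); exists (x * gen s).
by rewrite hgt_gen us hx; lia.
Qed.

(** A cell at [x] with an edge towards a known level has a known value. This leaves the cell on the
    other two edges, which the cycle equation on one of them determines; induction then goes up and
    down from height 0. *)
Lemma cycle_level0 (F : 'I_4 -> 'I_4 -> X -> R) : is_cycle F ->
  (forall s t x, hgt x = 0%Z -> F s t x = 0%Re) -> forall s t x, F s t x = 0%Re.
Proof.
move=> hF h0; have [h1 h2 h3] := hF.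
have step e x : (forall s t y, hgt y = (if e then hgt x + 1 else hgt x - 1)%Z -> F s t y = 0%Re) ->
    forall s t, F s t x = 0%Re.
  move=> IH; have known s t : fib_up (lab x) s = e -> F s t x = 0%Re.
    by move=> us; rewrite -h2; apply: IH; rewrite hgt_gen us.
  move=> c d; case: (eqVneq (fib_up (lab x) c) e) => [/known //|uc].
  case: (eqVneq (fib_up (lab x) d) e) => [ud|ud]; first by rewrite h1 known //; lra.
  have [->|ncd] := eqVneq c d; first exact: cycle_diag.
  have ucd : fib_up (lab x) c = fib_up (lab x) d by case: e uc ud {IH known}; do 2!case: fib_up.
  have := h3 c x; rewrite (bigD1 d) //= big1 ?Rplus_0_r // => t ntd.
  have [->|ntc] := eqVneq t c; first exact: cycle_diag.
  rewrite h1 known; first by lra.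
  have := @fib_two_two (lab x) c d t (lab_lt x) (ltn_ord c) (ltn_ord d) (ltn_ord t) ncd ntc ntd ucd.
  by move=> ->; case: e uc {IH known ud}; case: fib_up.
suff lev k : forall s t x, (hgt x = Z.of_nat k \/ hgt x = - Z.of_nat k)%Z -> F s t x = 0%Re.
  by move=> s t x; apply: (lev (Z.abs_nat (hgt x))); lia.
elim: k => [|k IH] s t x hx; first by apply: h0; lia.
case: hx => hx.
  by apply: (step false) => s' t' y hy; apply: IH; lia.
by apply: (step true) => s' t' y hy; apply: IH; lia.
Qed.

Local Notation Y := (X * 'I_4 * 'I_4)%type.

Definition cyc (f : hs Y) : Prop := is_cycle (fun s t x => f (x, s, t)).

Lemma cyc_closed : closed_subspace cyc.
Proof.
split.
- exists (vlin 0 0 (delta (1, ord0, ord0)) (delta (1, ord0, ord0))); split=> *; rewrite ?vlinE.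
  + by ring.
  + by ring.
  + by rewrite big1 // => t _; rewrite vlinE; ring.
- move=> a b f g [f1 f2 f3] [g1 g2 g3]; split=> [s t x|s t x|s x]; rewrite ?vlinE.
  + by rewrite f1 g1; ring.
  + by rewrite f2 g2.
  + under eq_bigr => t _ do rewrite vlinE.
    by rewrite big_split /= -!rsum_scale f3 g3; ring.
- move=> u f hu uf; split=> [s t x|s t x|s x].
  + apply: (UL_sequence _ _ _ (uf _)); have := CV_opp _ _ (uf (x, s, t)).
    by apply: Un_cv_ext => i; case: (hu i) => h _ _; rewrite h.
  + apply: (UL_sequence _ _ _ (uf _)); have := uf (x, s, t).
    by apply: Un_cv_ext => i; case: (hu i) => _ h _; rewrite h.
  + have := @cv_rsum 'I_4 (index_enum 'I_4) (fun i t => u i (x, s, t)) (fun t => f (x, s, t))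
      (fun t => uf (x, s, t)) => cv.
    apply: (UL_sequence _ _ _ cv) => e e0; exists 0%N => i _.
    by case: (hu i) => _ _ /(_ s x) ->; rewrite /R_dist Rminus_diag Rabs_R0.
Qed.

Lemma cycle_vanishes_4_3 (F : 'I_4 -> 'I_4 -> X -> R) :
  l2_cycle F -> forall s t x, F s t x = 0%Re.
Proof.
move=> [hF [C hC]] s t x.
have sF : summable (fun y : Y => (F y.1.2 y.2 y.1.1 ^ 2)%Re).
  split=> [y|]; first exact: pow2_ge_0.
  exists C => L uL; pose L1 : seq X := undup [seq v.1.1 | v <- L].
  apply: (Rle_trans _ _ _ _ (hC L1 (undup_uniq _))).
  apply: (Rle_trans _ (\rsum_(v <- [seq (z, a.1, a.2) | z <- L1,
      a <- index_enum ('I_4 * 'I_4)%type]) (F v.1.2 v.2 v.1.1 ^ 2))).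
    apply: rsum_sub_seq => // [[[z p] r] hz|y]; last exact: pow2_ge_0.
    apply/allpairsP; exists (z, (p, r)); split=> //=; last by rewrite mem_index_enum.
    by rewrite mem_undup; apply/mapP; exists (z, p, r).
  rewrite big_allpairs_dep; apply: rsum_le => z _.
  by right; rewrite pair_big /=.
pose f : hs Y := exist (fun f : Y -> R => summable (fun v : Y => (f v ^ 2)%Re))
  (fun v => F v.1.2 v.2 v.1.1) sF.
pose act g (y : Y) : Y := (g * y.1.1, y.1.2, y.2).
pose y0 : Y := (x, s, t).
pose hg k := proj1_sig (constructive_indefinite_description _ (height_surj k)).
have hgE k : hgt (hg k) = Z.of_nat k.
  exact: (proj2_sig (constructive_indefinite_description _ (height_surj k))).
suff : f y0 = 0%Re by [].
(* Functions are determined on height 0, whose orbits are told apart by label and pair of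
   generators; [hg k / x] moves [x] to height [k], so these translates lie in distinct orbits. *)
apply: (@trace_vanishing Y cyc cyc_closed (fun v => Z.eqb (hgt v.1.1) 0) _ X act _ _ _ _
  fib_ker _ _ _ _ ('I_6 * 'I_4 * 'I_4)%type
  (fun v => (inord (lab v.1.1), v.1.2, v.2)) _ y0 (fun k => hg k / x)).
- move=> h Vh h0 [[z p] r].
  apply: (cycle_level0 Vh) => p' r' z' hz; apply: h0; exact/Z.eqb_eq.
- by move=> g h [[z p] r]; rewrite /act /= mulgA.
- by move=> [[z p] r]; rewrite /act /= mul1g.
- by move=> g [[z p] r] [] /(canRL (mulgK z)); rewrite mulgV.
- move=> g h h' Vh E; have [c1 c2 c3] := is_cycle_translate g Vh.
  split=> [p r z|p r z|p z]; rewrite ?E; [exact: c1 | exact: c2 |].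
  by under eq_bigr => r _ do rewrite E; exact: c3.
- exact: fib1.
- by move=> g h Ng Nh; rewrite /fib_ker (fib_kerP _ Ng).
- exact: fib_kerV.
- by move=> g [[z p] r] Ng; rewrite /= /hgt (fib_kerP _ Ng).
- move=> [[z p] r] [[z' p'] r'] /Z.eqb_eq /= hz /Z.eqb_eq /= hz' [] el -> ->.
  exists (z' / z); last by rewrite /act /= mulgVK.
  apply: fib_ker_div; rewrite [fib z]surjective_pairing [fib z']surjective_pairing.
  rewrite -/(hgt z) -/(hgt z') hz hz'; congr (_, _).
  by have := congr1 val el; rewrite /= !inordK ?lab_lt.
- move=> i k g Ng; rewrite /act /= !mulgVK => -[E].
  by apply: Nat2Z.inj; rewrite -!hgE -E /hgt (fib_kerP _ Ng).
- exact: hF.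
Qed.

End Fibration.

(** * Cells and incidence numbers *)

Section Cosets.

Local Open Scope group_scope.

Context {n m : nat}.
Implicit Types (T v w : seq 'I_n) (x y u : cox n m) (i j s t : 'I_n).

Lemma same_cosetP T w w' : same_coset m T w w' <->
  exists2 v, Defs.over T v & mk w' = mk w * mk v :> cox n m.
Proof.
split=> [[v [ov /mk_eq e]]|[v ov e]]; exists v => //; first by rewrite -mkM.
by split=> //; apply/mk_eq; rewrite mkM.
Qed.

Lemma over_cat T v v' : Defs.over T v -> Defs.over T v' -> Defs.over T (v ++ v').
Proof. by rewrite /Defs.over all_cat => -> ->. Qed.

Lemma over_rev T v : Defs.over T v -> Defs.over T (rev v).
Proof. by rewrite /Defs.over all_rev. Qed.

Lemma same_coset_sym T w w' : same_coset m T w w' -> same_coset m T w' w.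
Proof.
move=> /same_cosetP[v ov e]; apply/same_cosetP; exists (rev v); first exact: over_rev.
by rewrite e -mkV mulgK.
Qed.

Lemma same_coset_trans T w w' w'' :
  same_coset m T w w' -> same_coset m T w' w'' -> same_coset m T w w''.
Proof.
move=> /same_cosetP[v ov e] /same_cosetP[v' ov' e']; apply/same_cosetP.
by exists (v ++ v'); [exact: over_cat | rewrite e' e mkM mulgA].
Qed.

Lemma minrepP T w : same_coset m T w (minrep m T w) /\ min_coset_rep m T (minrep m T w).
Proof.
refine (epsilon_spec (inhabits [::]) (fun w0 => same_coset m T w w0 /\ min_coset_rep m T w0) _).
have [k] : exists k, exists w0, same_coset m T w w0 /\ size w0 = k.
  by exists (size w), w; split=> //; apply/same_cosetP; exists [::]; rewrite ?mk1 ?mulg1.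
elim/ltn_ind: k => k IH [u [cu su]].
case: (excluded_middle_informative
  (exists w0, same_coset m T w w0 /\ size w0 < k)) => [[u' [cu' su']]|no].
  by apply: (IH _ su'); exists u'.
exists u; split=> // v w' ov e; rewrite su leqNgt; apply/negP => lt; apply: no.
exists w'; split=> //; apply: same_coset_trans cu _.
by exists v.
Qed.

Lemma minrep_coset T w w' : same_coset m T w w' -> minrep m T w = minrep m T w'.
Proof.
move=> ww'; rewrite /minrep; congr (epsilon _ _).
apply: functional_extensionality => u; apply: propositional_extensionality.
split=> -[h1 h2]; split=> //.
- exact: same_coset_trans (same_coset_sym ww') h1.
- exact: same_coset_trans ww' h1.
Qed.

Lemma len_minrep T w : len (mk (minrep m T w) : cox n m) = size (minrep m T w).
Proof.
apply/eqP; rewrite eqn_leq len_mk /=; apply: ((minrepP T w).2 [::]) => //.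
by rewrite cats0; apply: ce_sym; exact: val_mk.
Qed.

Lemma minrep_min i j w : min_in_coset i j (mk (minrep m [:: i; j] w) : cox n m).
Proof.
move=> v ov; rewrite len_minrep; apply: ((minrepP [:: i; j] w).2 v) => //.
by rewrite -mkM; apply: ce_sym; exact: val_mk.
Qed.

Lemma gate_asc i j u k : i != j -> min_in_coset i j u -> k < m ->
  ~~ desc (u * altx i j k) (if odd k then j else i).
Proof.
move=> nij mu km; rewrite /desc -mulgA -altx_rcons (gate nij mu km) (gate nij mu (ltnW km)).
by rewrite ltn_add2l -leqNgt.
Qed.

Lemma gate_desc i j u k : i != j -> min_in_coset i j u -> k < m ->
  desc (u * altx i j k.+1) (if odd k then j else i).
Proof.
move=> nij mu km; rewrite /desc [altx i j k.+1]altx_rcons mulgA mulgenK -mulgA -altx_rcons.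
by rewrite (gate nij mu km) (gate nij mu (ltnW km)) ltn_add2l.
Qed.

(** Every edge of the polygon, named by its lower end, lies on one of the two paths from the bottom
    to the top. *)
Lemma ascending_edge i j s u y v : 0 < m -> i != j -> s \in [:: i; j] -> min_in_coset i j u ->
  Defs.over [:: i; j] v -> y = u * mk v -> ~~ desc y s ->
  exists2 k, k < m & y = u * altx i j k /\ s = (if odd k then j else i) \/
                     y = u * altx j i k /\ s = (if odd k then i else j).
Proof.
move=> m0 nij hs mu ov ey ds.
have side i' j' k : i' != j' -> min_in_coset i' j' u -> s \in [:: i'; j'] -> k <= m ->
    y = u * altx i' j' k ->
  exists2 k, k < m & y = u * altx i' j' k /\ s = (if odd k then j' else i') \/
                     y = u * altx j' i' k /\ s = (if odd k then i' else j').
  move=> nij' mu' hs' km e; case: k km e => [|k] km e.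
    exists 0 => //; move: hs'; rewrite !inE => /orP[] /eqP -> /=; [left|right]; split=> //.
  have := gate_desc nij' mu' km; rewrite -e => dk.
  have sk : s = if odd k then i' else j'.
    by move: hs' ds dk; rewrite !inE => /orP[] /eqP ->; case: odd => // /negbTE ->.
  (* Position [m] is the end of both paths, so both letters would descend there. *)
  have km' : k.+1 < m.
    rewrite ltn_neqAle km andbT; apply/eqP => k1m.
    move: ds; rewrite sk e [altx i' j' k.+1](_ : _ = altx j' i' k.+1); last first.
      by rewrite k1m altx_mid.
    by rewrite gate_desc // 1?eq_sym //; exact: min_in_coset_sym.
  by exists k.+1 => //; left; split=> //=; case: odd sk.
have [k km [e|e]] := over_alt nij m0 ov.
  by apply: (side i j k) => //; rewrite ey e.
have [|||||k' km' h] := side j i k.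
- by rewrite eq_sym.
- exact: min_in_coset_sym.
- by move: hs; rewrite !inE orbC.
- exact: km.
- by rewrite ey e.
by exists k' => //; tauto.
Qed.

Lemma over1 s v : Defs.over [:: s] v -> (mk v : cox n m) = 1 \/ (mk v : cox n m) = gen s.
Proof.
elim: v => [|p v IH] /=; first by left.
rewrite inE => /andP[/eqP -> /IH [] e]; rewrite mk_cons e; first by right; rewrite mulg1.
by left; rewrite genK.
Qed.

Lemma edge_matchP e s w : edge_match m e s w <->
  e.2 = s /\ ((mk e.1 : cox n m) = mk w \/ (mk e.1 : cox n m) * gen s = mk w).
Proof.
split=> [[-> /same_cosetP[v /over1 [] -> ->]]|[es h]].
- by rewrite mulg1; split=> //; left.
- by split=> //; right.
- split=> //; apply/same_cosetP; case: h => <-.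
    by exists [::] => //; rewrite mk1 mulg1.
  by exists [:: s] => //=; rewrite /Defs.over /= mem_head.
Qed.

End Cosets.

Definition eps (k : nat) : R := if odd k then (-1)%Re else 1%Re.

Lemma epsD k l : eps (k + l) = (eps k * eps l)%Re.
Proof. by rewrite /eps oddD; case: odd; case: odd => /=; lra. Qed.

Lemma eps_sq k : (eps k * eps k = 1)%Re.
Proof. by rewrite /eps; case: odd; lra. Qed.

Lemma em_true (P : Prop) (a b : R) : P -> (if excluded_middle_informative P then a else b) = a.
Proof. by case: excluded_middle_informative. Qed.

Lemma em_false (P : Prop) (a b : R) : ~ P -> (if excluded_middle_informative P then a else b) = b.
Proof. by case: excluded_middle_informative. Qed.

(** * Incidence numbers as products of signs *)

Section Incidence.

Local Open Scope group_scope.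

Context {n m : nat} (m0 : 0 < m).
Implicit Types (w : seq 'I_n) (i j s t : 'I_n).

Local Open Scope R_scope.

Lemma foldr_rsum (A : Type) (h : A -> R) (L : seq A) :
  foldr (fun e r => h e + r) 0 L = \rsum_(e <- L) h e.
Proof. by elim: L => [|e L IH] /=; rewrite ?big_nil // big_cons IH. Qed.

Lemma rsum_iota_one (h : nat -> R) k0 : (k0 < m)%N -> (forall k, (k < m)%N -> k != k0 -> h k = 0) ->
  \rsum_(k <- iota 0 m) h k = h k0.
Proof.
move=> km hk; rewrite (bigD1_seq k0) ?iota_uniq ?mem_iota //= big1_seq ?Rplus_0_r //.
by move=> k /andP[nk]; rewrite mem_iota => /andP[_ km']; exact: hk.
Qed.

Definition lower s (x : cox n m) := if desc x s then (x * gen s)%g else x.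

(** The edge occurs once in the boundary, at position [k0] of one side. Letters alternate along a
    side, so the sign of the side is [eps k0] times the sign of [s] in the pair, and [k0] is the
    length of the lower end of the edge minus that of the bottom. *)
Lemma incidenceE i j s w : i != j -> s \in [:: i; j] ->
  incidence m i j w s w =
  eps (len (lower s (mk w : cox n m))) * eps (size (minrep m [:: i; j] w)) *
  (if s == i then 1 else -1).
Proof.
move=> nij hs; rewrite /incidence /bdry2; set uw := minrep m [:: i; j] w.
pose u : cox n m := mk uw; pose y := lower s (mk w : cox n m).
have mu : min_in_coset i j u := @minrep_min n m i j w.
have mu' := min_in_coset_sym mu; have nji : j != i by rewrite eq_sym.
have lu : len u = size uw by exact: len_minrep.
have yasc : ~~ desc y s.
  by rewrite /y /lower; case: ifP => [d|->//]; rewrite desc_gen d.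
have [v ov ey] : exists2 v, Defs.over [:: i; j] v & y = (u * mk v)%g.
  have /same_coset_sym/same_cosetP[v ov e] := (@minrepP n m [:: i; j] w).1.
  rewrite /y /lower e; case: ifP => _; last by exists v.
  exists (v ++ [:: s]); last by rewrite mkM mulgA.
  by apply: over_cat => //; rewrite /Defs.over /= hs.
have matchP (z : cox n m) : ~~ desc z s ->
    (z = mk w \/ (z * gen s)%g = mk w) <-> z = y.
  move=> dz; rewrite /y /lower; split.
    case=> e; first by rewrite -e (negbTE dz).
    by rewrite -e desc_gen dz mulgenK.
  by move=> ->; case: ifP => _; [right; rewrite mulgenK | left].
have [k0 km hy] := ascending_edge m0 nij hs mu ov ey yasc.
have ly : len y = (len u + k0)%N.
  by case: hy => -[-> _]; apply: gate => //; exact: ltnW.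
have side i' j' (c : R) : i' != j' -> min_in_coset i' j' u ->
   \rsum_(e <- [seq (uw ++ alt i' j' k, (if odd k then j' else i'), c) | k <- iota 0 m])
      (if excluded_middle_informative (edge_match m e.1 s w) then e.2 else 0) =
   if excluded_middle_informative (y = (u * altx i' j' k0)%g /\ s = (if odd k0 then j' else i'))
   then c else 0.
  move=> nij' mij'; rewrite big_map.
  have E k : (k < m)%N -> edge_match m (uw ++ alt i' j' k, (if odd k then j' else i')) s w <->
      (y = (u * altx i' j' k)%g /\ s = (if odd k then j' else i')).
    move=> km'; rewrite edge_matchP /= mkM -/u -/(altx i' j' k).
    have := gate_asc nij' mij' km'; split.
      by case=> ps /matchP; rewrite -ps => ->.
    by case=> e ps; rewrite -ps; split=> //; apply/matchP; rewrite // ps.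
  rewrite (rsum_iota_one km) => [|k km' nk] /=.
    case: excluded_middle_informative => h; case: excluded_middle_informative => h' //.
      by case: h'; apply/E.
    by case: h; apply/E.
  case: excluded_middle_informative => //= h; have [e _] := (E k km').1 h; case/eqP: nk.
  by apply/eqP; rewrite -(eqn_add2l (len u)) -ly e gate // ltnW.
rewrite (foldr_rsum (fun e => if excluded_middle_informative (edge_match m e.1 s w) then e.2 else 0)).
rewrite big_cat /= !side // -/y ly -lu epsD.
have -> : eps (len u) * eps k0 * eps (len u) = eps k0.
  by rewrite [eps (len u) * eps k0]Rmult_comm Rmult_assoc eps_sq Rmult_1_r.
have other (i' j' : 'I_n) : i' != j' -> s = (if odd k0 then j' else i') ->
    s <> (if odd k0 then i' else j').
  by case: odd => nij' -> /eqP; rewrite ?(negbTE nij') // eq_sym (negbTE nij').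
rewrite /eps; case: hy => -[e1 e2].
- rewrite em_true // em_false => [|[_]]; last exact: other.
  by rewrite e2; case: odd; rewrite ?eqxx ?(negbTE nji); lra.
- rewrite em_false => [|[_]]; last exact: other.
  rewrite em_true //.
  by rewrite e2; case: odd; rewrite ?eqxx ?(negbTE nji); lra.
Qed.

End Incidence.

(** * From weighted chains to unweighted cycles *)

Section ChainToCycle.

Local Open Scope group_scope.

Context {n m : nat} (m0 : 0 < m) (q : 'I_n -> R).
Context (hq0 : forall s, (0 < q s)%Re) (hq1 : forall s, (q s <= 1)%Re).
Context (f : 'I_n -> 'I_n -> seq 'I_n -> R).
Context (hf : two_chain m f) (hs2 : sq_summable m q f) (hc : q_cycle2 m q f).
Implicit Types (w : seq 'I_n) (x y u : cox n m) (i j s t : 'I_n).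

Local Open Scope R_scope.

Lemma cellweight_bounds T w : 0 < cellweight m q T w <= 1.
Proof.
rewrite /cellweight; elim: (minrep m T w) => [|s v IH] /=; first by lra.
have := hq0 s; have := hq1 s; move: IH; rewrite -/(wordweight q v); nra.
Qed.

(** The weighted value is twisted by the sign of the bottom of the cell; by [incidenceE] this leaves
    the orientation sign and a factor common to all cells at an edge. *)
Definition flux i j w := eps (size (minrep m [:: i; j] w)) * cellweight m q [:: i; j] w * f i j w.

Definition cycle_of s t x :=
  if (s < t)%N then flux s t (val x) else if (t < s)%N then - flux t s (val x) else 0.

Lemma flux_coset i j w w' : (i < j)%N -> same_coset m [:: i; j] w w' -> flux i j w = flux i j w'.
Proof. by move=> ij ww'; rewrite /flux /cellweight (minrep_coset ww') (hf ij ww'). Qed.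

Lemma cycle_of_anti s t x : cycle_of t s x = - cycle_of s t x.
Proof. by rewrite /cycle_of; case: ltngtP => _; lra. Qed.

Lemma cycle_of_gen s t x : cycle_of s t (x * gen s)%g = cycle_of s t x.
Proof.
have co i j : s \in [:: i; j] -> same_coset m [:: i; j] (val (x * gen s)%g) (val x).
  move=> hs; apply/same_cosetP; exists [:: s]; first by rewrite /Defs.over /= hs.
  by rewrite !mkK mulgenK.
rewrite /cycle_of; case: ltngtP => // h; rewrite (flux_coset h (co _ _ _)) //.
  by rewrite mem_head.
by rewrite !inE eqxx orbT.
Qed.

(** Multiplied by the sign [e] of the lower end of the edge, the sum becomes the weighted cycle
    equation term by term. *)
Lemma cycle_of_sum s x : \rsum_t cycle_of s t x = 0.
Proof.
pose e := eps (len (lower s x)).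
have e0 : e * e = 1 := eps_sq _.
suff E : e * (\rsum_t cycle_of s t x) = 0.
  by rewrite -[LHS]Rmult_1_l -e0 Rmult_assoc E; ring.
rewrite (bigD1 s) //= {1}/cycle_of ltnn Rplus_0_l rsum_scale.
have := hc s (val x); rewrite foldrE big_map big_filter big_enum_cond /= => E; rewrite -[RHS]E {E} -[sval x]/(val x).
apply: eq_big => [t|t nts]; first by [].
rewrite /cycle_of; case: ltngtP => h.
- rewrite incidenceE //; last by rewrite mem_head.
  + by rewrite mkK -/e eqxx /flux; ring.
  + by rewrite eq_sym.
- rewrite incidenceE //; last by rewrite !inE eqxx orbT.
  by rewrite mkK -/e eq_sym (negbTE nts) /flux; ring.
- by case/eqP: nts; apply/val_inj.
Qed.

Lemma bottom_coset_eq i j u u' : i != j -> bottom u i j -> bottom u' i j ->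
  same_coset m [:: i; j] (val u) (val u') -> u = u'.
Proof.
move=> nij /andP[di dj] /andP[di' dj'] /same_cosetP[v ov]; rewrite !mkK => e.
have mu := bottomP nij m0 di dj; have mu' := bottomP nij m0 di' dj'.
have le' : (len u' <= len u)%N.
  have := mu' _ (over_rev ov); rewrite e -mkV mulgK; exact.
have [k km ek] := over_alt nij m0 ov.
have lk : len u' = (len u + k)%N.
  rewrite e; case: ek => ->; first exact: gate.
  by apply: gate => //; [rewrite eq_sym | exact: min_in_coset_sym].
have k0 : k = 0%N by move: le'; rewrite lk; lia.
by move: ek; rewrite k0 !altx0 => -[] ev; rewrite e ev mulg1.
Qed.

(** Restricting to bottoms counts each cell at most once, by [bottom_coset_eq]. *)
Lemma bottom_sum_bounded : exists C, 0 <= C /\ forall i j (L : seq (cox n m)),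
  (i < j)%N -> uniq L -> \rsum_(u <- L | bottom u i j) (cycle_of i j u ^ 2) <= C.
Proof.
have [C hC] := hs2; exists C; split; first by have := hC [::] isT I.
move=> i j L ij uL; have nij : i != j by rewrite neq_ltn ij.
pose Lc := [seq (i, j, val u) | u <- [seq u <- L | bottom u i j]].
have dc : distinct_cells m Lc.
  rewrite /Lc {Lc}; elim: L uL => //= u L IH /andP[uL /IH dL].
  case: ifP => // bu /=; split=> // c /mapP[u' ]; rewrite mem_filter => /andP[bu' u'L] -> [_] /= co.
  by move: uL; rewrite (bottom_coset_eq nij bu bu' co) u'L.
have ac : all (fun c : 'I_n * 'I_n * seq 'I_n => c.1.1 < c.1.2)%N Lc.
  by rewrite all_map; apply/allP => u _.
apply: Rle_trans (hC Lc ac dc).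
rewrite (foldr_rsum (fun c : 'I_n * 'I_n * seq 'I_n =>
  f c.1.1 c.1.2 c.2 ^ 2 * cellweight m q [:: c.1.1; c.1.2] c.2)) big_map big_filter.
apply: rsum_le => u _.
change (cycle_of i j u ^ 2 <= f i j (val u) ^ 2 * cellweight m q [:: i; j] (val u)).
rewrite /cycle_of ij /flux.
have [w0 w1] := cellweight_bounds [:: i; j] (val u).
have := eps_sq (size (minrep m [:: i; j] (val u))).
set e := eps _; set c := cellweight _ _ _ _; set z := f _ _ _ => ee.
have -> : (e * c * z) ^ 2 = (e * e) * (c ^ 2 * z ^ 2) by ring.
(* Here [q <= 1] enters: the measure [c] is at most 1, so [c ^ 2 <= c]. *)
rewrite ee Rmult_1_l Rmult_comm; apply: Rmult_le_compat_l; first exact: pow2_ge_0.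
by rewrite -/c in w0 w1; nra.
Qed.

Lemma cycle_of_cycle : is_cycle cycle_of.
Proof. by split; [exact: cycle_of_anti | exact: cycle_of_gen | exact: cycle_of_sum]. Qed.

(** Every vertex is a bottom times one of the alternating words in [ds], so for each pair the sum
    over vertices is at most one copy of [C] for each entry of [ds]. *)
Lemma cycle_of_l2 : l2_cycle cycle_of.
Proof.
split; first exact: cycle_of_cycle.
have [C [C0 hC]] := bottom_sum_bounded.
pose ds i j : seq (cox n m) := [seq altx i j k | k <- iota 0 m.+1] ++ [seq altx j i k | k <- iota 0 m.+1].
have one i j (L : seq (cox n m)) : (i < j)%N -> uniq L ->
    \rsum_(x <- L) (cycle_of i j x ^ 2) <= \rsum_(d <- ds i j) C.
  move=> ij uL; have nij : i != j by rewrite neq_ltn ij.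
  have const d x : d \in ds i j -> cycle_of i j (x * d^-1)%g = cycle_of i j x.
    rewrite mem_cat => /orP[] /mapP[k _ ->]; rewrite altxV; case: odd;
    by apply: (cycle_alt _ _ cycle_of_cycle); rewrite !inE eqxx ?orbT.
  apply: Rle_trans (_ : _ <= \rsum_(d <- ds i j)
      \rsum_(u <- [seq (x * d^-1)%g | x <- L] | bottom u i j) (cycle_of i j u ^ 2)) _; last first.
    apply: rsum_le => d _; apply: hC => //.
    by rewrite map_inj_uniq //; exact: mulIg.
  under [X in _ <= X]eq_bigr => d _ do rewrite big_map.
  rewrite [X in _ <= X](exchange_big_dep predT) //=; apply: rsum_le => x _.
  have [u [k [mu km e]]] := coset_min x nij m0.
  have bu : bottom u i j.
    by apply/andP; split; [have := mu [:: i] | have := mu [:: j]];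
      rewrite /Defs.over /= !inE eqxx ?orbT /desc -leqNgt; apply.
  have [d dd ex] : exists2 d, d \in ds i j & x = (u * d)%g.
    case: e => e; [exists (altx i j k) | exists (altx j i k)] => //; rewrite mem_cat;
      apply/orP; [left | right]; apply/mapP; exists k => //; by rewrite mem_iota.
  apply: Rle_trans (_ : _ <= \rsum_(d0 <- [:: d] | bottom (x * d0^-1)%g i j)
      (cycle_of i j (x * d0^-1)%g ^ 2)) _.
    have hb : bottom (x * d^-1)%g i j by rewrite ex mulgK.
    by rewrite big_cons big_nil hb const //; lra.
  rewrite big_mkcond [X in _ <= X]big_mkcond /=.
  apply: rsum_sub_seq => // [d0|d0]; first by rewrite inE => /eqP ->.
  by case: bottom; nra.
exists (\rsum_s \rsum_t \rsum_(d <- ds s t) C) => L uL.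
rewrite exchange_big /=; apply: rsum_le => s _; rewrite exchange_big /=; apply: rsum_le => t _.
have dsC i j : size (ds i j) = size (ds s t) by rewrite !size_cat !size_map.
have cst i j : \rsum_(d <- ds i j) C = \rsum_(d <- ds s t) C.
  move: (dsC i j); elim: (ds i j) (ds s t) => [|d r IH] [|d' r'] //= [] /IH h.
  by rewrite !big_cons h.
case: (ltngtP s t) => [st|ts|/val_inj ->]; first exact: one.
  rewrite -(cst t s); apply: Rle_trans (one t s L ts uL).
  by right; apply: eq_bigr => x _; rewrite cycle_of_anti; ring.
rewrite big1 => [|x _]; first by apply: rsum_ge0.
by rewrite (cycle_diag _ _ cycle_of_cycle); ring.
Qed.

Lemma chain_vanishes : (forall s t x, cycle_of s t x = 0) ->
  forall i j w, (i < j)%N -> f i j w = 0.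
Proof.
move=> h i j w ij; have := h i j (mk w); rewrite /cycle_of ij.
have co : same_coset m [:: i; j] (val (mk w : cox n m)) w.
  by apply/same_cosetP; exists [::]; rewrite // mkK mk1 mulg1.
rewrite (flux_coset ij co) /flux; have := cellweight_bounds [:: i; j] w.
have := eps_sq (size (minrep m [:: i; j] w)).
set e := eps _; set c := cellweight _ _ _ _ => ee [c0 _] h0.
have : e * (e * c * f i j w) = 0 by rewrite h0; ring.
have -> : e * (e * c * f i j w) = (e * e) * (c * f i j w) by ring.
by rewrite ee Rmult_1_l => /Rmult_integral[]; lra.
Qed.

End ChainToCycle.

(** For [m = 2] the generators commute, so repeated letters cancel and every word reduces to one of
    length at most [n]. *)
Lemma spherical_all_commuting n (T : seq 'I_n) : spherical 2 T.
Proof.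
pose X := cox n 2.
have comm (i j : 'I_n) : (gen i * gen j = gen j * gen i :> X)%g.
  have [->//|nij] := eqVneq i j; have := @altx_mid n 2 i j nij.
  by rewrite !altxS !altx0 !mulg1.
have commw (i : 'I_n) (w : seq 'I_n) : (gen i * mk w = mk w * gen i :> X)%g.
  elim: w => [|j w IH]; first by rewrite mk1 mulg1 mul1g.
  by rewrite mk_cons mulgA comm -!mulgA IH.
exists n => v _.
suff [v' e uv'] : exists2 v', mk v = mk v' :> X & uniq v'.
  exists v'; split; first exact/mk_eq.
  by rewrite -(card_uniqP uv') -[X in _ <= X]card_ord max_card.
elim: v => [|i v [v' e uv']]; first by exists [::].
have [iv'|iv'] := boolP (i \in v'); last first.
  by exists (i :: v') => /=; [rewrite !mk_cons e | rewrite iv' uv'].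
move: e uv'; case/splitPr: iv' => p1 p2 e; rewrite uniq_catC /= => /andP[_ u12].
exists (p1 ++ p2); last by rewrite uniq_catC.
rewrite mk_cons e !mkM mk_cons mulgA (commw i p1) -mulgA.
by rewrite (mulgA (gen i)) genK mul1g.
Qed.

Theorem theorem7p6 (n m : nat) (hn : 3 <= n) (hm : n.-1 <= m)
  (hsph2 : forall i j : 'I_n, spherical m [:: i; j])
  (hsph3 : forall i j k : 'I_n, i != j -> j != k -> i != k ->
             ~ spherical m [:: i; j; k])
  (q : 'I_n -> R) (hq0 : forall s, (0 < q s)%Re) (hq1 : forall s, (q s <= 1)%Re)
  (hqc : conj_invariant m q) :
  L2qH2_vanishes m q.
Proof.
(* If [m <= 2] then [n = 3] and [m = 2], and the three generators form a spherical triple. *)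
have m3 : 3 <= m.
  rewrite ltnNge; apply/negP => m2; have m_2 : m = 2 by lia.
  rewrite m_2 in hsph3.
  apply: (hsph3 (Ordinal (ltnW (ltnW hn))) (Ordinal (ltnW hn)) (Ordinal hn)) => //.
  exact: spherical_all_commuting.
have m0 : 0 < m by lia.
move=> f hf hs2 hc.
apply: (chain_vanishes hq0 hq1 hf).
have hF := cycle_of_l2 m0 hq0 hq1 hf hs2 hc.
(* As [n - 1 <= m] and [m >= 3], the inequality [n - 2 <= 2 * m - 5] fails only for [n = 4],
   [m = 3]. *)
case: (n =P 4) => [n4|n4]; last by apply: rooted_cycle_vanishes hF; lia.
case: (m =P 3) => [m_3|m_3]; last by apply: rooted_cycle_vanishes hF; lia.
move: hF; move: (cycle_of q f) => F {hsph2 hsph3 hqc hf hs2 hc hq0 hq1 hn hm m3 m0 q f}; subst n m.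
exact: cycle_vanishes_4_3.
Qed.
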